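(* There is an algorithm which, given a block graph $G=(V,E)$ with $n=|V|\ge 2$ vertices and $m=|E|$ edges, together with a vertex ordering $v_1,v_2,\dots,v_n$ of $G$ such that $v_iv_j\in E$ and $v_iv_k\in E$ imply $v_jv_k\in E$ whenever $i<j<k\le n$, outputs a minimum paired-dominating set of $G$ in $O(m+n)$ time.
   Context: All graphs are finite, simple and without isolated vertices. A block of a graph is a maximal connected subgraph without a cut-vertex; a block graph is a connected graph all of whose blocks are complete graphs. A set $S\subseteq V$ is a paired-dominating set of $G$ if every vertex of $V\setminus S$ is adjacent to a vertex of $S$ and the induced subgraph $G[S]$ has a perfect matching. A minimum paired-dominating set is one of minimum cardinality; this cardinality is the paired-domination number $\gamma_p(G)$. *)

(* Defs.v *)
From mathcomp Require Import all_boot perm.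

Set Implicit Arguments.
Unset Strict Implicit.
Unset Printing Implicit Defensive.

(** * Graphs *)

(** The vertex set is carried separately from the type so that subgraphs,
    induced subgraphs and vertex deletions are graphs over the same type. *)
Record graph (T : finType) := Graph { verts : {set T}; adj : rel T }.

Section Graphs.
Variable T : finType.
Implicit Types (G H K : graph T) (S D : {set T}) (M : {set {set T}}).

Definition simple_graph G : Prop :=
  [/\ symmetric (adj G), irreflexive (adj G)
    & forall x y, adj G x y -> (x \in verts G) && (y \in verts G)].

Definition no_isolated_vertex G : Prop :=
  forall x, x \in verts G -> exists y, adj G x y.

Definition edges G : {set {set T}} :=
  [set [set p.1; p.2] | p : T * T & adj G p.1 p.2].

Definition subgraph H G : Prop :=
  verts H \subset verts G /\ subrel (adj H) (adj G).

Definition induced G S : graph T :=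
  Graph (verts G :&: S) [rel x y | [&& x \in S, y \in S & adj G x y]].

Definition del_vertex G v : graph T := induced G [set~ v].

Definition connected G : Prop :=
  verts G != set0 /\ {in verts G &, forall x y, connect (adj G) x y}.

(** A cut-vertex separates two other vertices of its component. *)
Definition cut_vertex G v : Prop :=
  v \in verts G /\
  exists x y, [/\ x \in verts G :\ v, y \in verts G :\ v,
    connect (adj G) x y & ~~ connect (adj (del_vertex G v)) x y].

Definition nonseparable G : Prop :=
  connected G /\ forall v, ~ cut_vertex G v.

Definition block G H : Prop :=
  [/\ simple_graph H, subgraph H G, nonseparable H
    & forall K, simple_graph K -> subgraph K G -> nonseparable K ->
        subgraph H K -> subgraph K H].

Definition complete G : Prop :=
  {in verts G &, forall x y, x != y -> adj G x y}.

Definition block_graph G : Prop :=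
  [/\ simple_graph G, connected G & forall H, block G H -> complete H].

Definition perfect_matching G M : Prop :=
  M \subset edges G /\ partition M (verts G).

Definition paired_dominating G S : Prop :=
  [/\ S \subset verts G,
      forall x, x \in verts G -> x \notin S -> exists2 y, y \in S & adj G x y
    & exists M, perfect_matching (induced G S) M].

Definition minimum_paired_dominating G S : Prop :=
  paired_dominating G S /\
  forall D, paired_dominating G D -> #|S| <= #|D|.

End Graphs.

(** * Word-RAM programs *)

(** A program owns finitely many registers and finitely many arrays, both named
    by naturals. Words have [w] bits: [+] wraps around modulo [2 ^ w] and [-] is
    truncated at 0. There is no multiplication. The cost of a run is the number
    of operations carried out: constants, register and array accesses,
    arithmetic, comparisons, Boolean connectives, assignments and branchings
    each count for one. *)

Inductive exp :=
  | Cst of nat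
  | Reg of nat
  | Arr of nat & exp
  | Add of exp & exp
  | Sub of exp & exp.

Inductive test :=
  | Eq of exp & exp
  | Lt of exp & exp
  | Not of test
  | And of test & test.

Inductive cmd :=
  | Skip
  | SetReg of nat & exp
  | SetArr of nat & exp & exp
  | Seq of cmd & cmd
  | If of test & cmd & cmd
  | While of test & cmd.

Record store := Store { reg : nat -> nat; arr : nat -> nat -> nat }.

Definition set_reg (s : store) (x k : nat) : store :=
  Store (fun y => if y == x then k else reg s y) (arr s).

Definition set_arr (s : store) (a i k : nat) : store :=
  Store (reg s)
    (fun b j => if (b == a) && (j == i) then k else arr s b j).

Fixpoint eval (w : nat) (s : store) (e : exp) : nat :=
  match e with
  | Cst k => k %% 2 ^ w
  | Reg x => reg s x
  | Arr a e1 => arr s a (eval w s e1)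
  | Add e1 e2 => (eval w s e1 + eval w s e2) %% 2 ^ w
  | Sub e1 e2 => eval w s e1 - eval w s e2
  end.

Fixpoint exp_cost (e : exp) : nat :=
  match e with
  | Cst _ | Reg _ => 1
  | Arr _ e1 => (exp_cost e1).+1
  | Add e1 e2 | Sub e1 e2 => (exp_cost e1 + exp_cost e2).+1
  end.

Fixpoint holds (w : nat) (s : store) (b : test) : bool :=
  match b with
  | Eq e1 e2 => eval w s e1 == eval w s e2
  | Lt e1 e2 => eval w s e1 < eval w s e2
  | Not b1 => ~~ holds w s b1
  | And b1 b2 => holds w s b1 && holds w s b2
  end.

Fixpoint test_cost (b : test) : nat :=
  match b with
  | Eq e1 e2 | Lt e1 e2 => (exp_cost e1 + exp_cost e2).+1
  | Not b1 => (test_cost b1).+1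
  | And b1 b2 => (test_cost b1 + test_cost b2).+1
  end.

(** [exec w p s t s']: started in [s], [p] halts in [s'] at cost [t]. *)
Inductive exec (w : nat) : cmd -> store -> nat -> store -> Prop :=
  | ExecSkip s : exec w Skip s 1 s
  | ExecSetReg s x e :
      exec w (SetReg x e) s (exp_cost e).+1 (set_reg s x (eval w s e))
  | ExecSetArr s a e1 e2 :
      exec w (SetArr a e1 e2) s (exp_cost e1 + exp_cost e2).+1
        (set_arr s a (eval w s e1) (eval w s e2))
  | ExecSeq s s1 s2 p1 p2 t1 t2 :
      exec w p1 s t1 s1 -> exec w p2 s1 t2 s2 ->
      exec w (Seq p1 p2) s (t1 + t2) s2
  | ExecIfTrue s s1 b p1 p2 t :
      holds w s b -> exec w p1 s t s1 ->
      exec w (If b p1 p2) s (test_cost b + t).+1 s1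
  | ExecIfFalse s s1 b p1 p2 t :
      ~~ holds w s b -> exec w p2 s t s1 ->
      exec w (If b p1 p2) s (test_cost b + t).+1 s1
  | ExecWhileTrue s s1 s2 b p t1 t2 :
      holds w s b -> exec w p s t1 s1 -> exec w (While b p) s1 t2 s2 ->
      exec w (While b p) s (test_cost b + t1 + t2).+1 s2
  | ExecWhileFalse s b p :
      ~~ holds w s b -> exec w (While b p) s (test_cost b).+1 s.

(** * Input and output *)

Definition adjacency_lists n (G : graph 'I_n) (nb : 'I_n -> seq 'I_n) : Prop :=
  forall u, uniq (nb u) /\ forall x, (x \in nb u) = adj G u x.

(** Register 0 holds [n]. The adjacency lists are concatenated in array 1, and
    the list of [u] starts at the position held by cell [u] of array 0 and ends
    just before the one held by cell [u.+1]. Cell [i] of array 2 holds the vertex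
    of rank [i] in the ordering [v]. All other cells hold 0. *)
Definition input n (nb : 'I_n -> seq 'I_n) (v : 'S_n) : store :=
  Store
    (fun x => if x == 0 then n else 0)
    (fun a i => match a with
     | 0 => if i <= n then \sum_(u < n | u < i) size (nb u) else 0
     | 1 => nth 0 [seq val x | x <- flatten [seq nb u | u <- enum 'I_n]] i
     | 2 => nth 0 [seq val (v u) | u <- enum 'I_n] i
     | _ => 0
     end).

(** The output is the set whose characteristic vector is array 3. *)
Definition output n (s : store) : {set 'I_n} := [set u : 'I_n | arr s 3 u != 0].

(* Main.v *)
(** Layer the block graph by the distance from a root. Two neighbours of a vertex that are joined by a
    path avoiding it lie in a common block, hence are adjacent; so every vertex but
    the root has exactly one neighbour on the level above (its parent), adjacent
    vertices of one level have the same parent, and adjacency within a level is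
    transitive.

    Paired domination is relaxed to choosing as few edges as possible, not
    necessarily disjoint, whose ends dominate. Take an undominated vertex of
    maximal depth, with parent [p]. If some neighbour of [p] on its level also has
    an undominated child, an exchange argument shows that the edge joining it to
    [p] may be chosen; otherwise the edge from [p] to its parent may. If the
    parent of [p] has been chosen before, the undominated child of [p] can serve
    as its partner instead. The chosen edges are then disjoint, so that the greedy
    solution of the relaxed problem is a paired-dominating set. *)

Require Import Defs.
From mathcomp Require Import all_boot perm zify.

Set Implicit Arguments.
Unset Strict Implicit.
Unset Printing Implicit Defensive.

(** * Cliques of block graphs *)

(** Optimality is carried by [ext S k]: [k] more edges complete [S]. Any paired-dominating set
    supplies the initial [k], and every pair the greedy adds must lower [k] by one. Each exchange
    rests on one fact: an edge covering a deepest undominated [v] with parent [p] covers, among the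
    undominated vertices, only neighbours of [p] and of one vertex of the block above [p] (closed
    neighbourhoods). The obstacle is linear time: the deepest undominated vertex cannot be searched
    for afresh. One undominated child per parent is recorded instead, and two indices run backwards
    through the breadth-first queue, so that a level is served after all deeper vertices have been
    examined and before its own vertices are. A record could become stale through a later choice; it
    does not while its parent is unselected, because pairs chosen for a level dominate, one level
    below, only children of selected vertices. Each vertex then pays for its neighbour list once
    when it is expanded, at most once when it is served and once when it is examined. *)

Section BlockGraph.
Variable T : finType.
Implicit Types (G H K : graph T) (x y : T) (p : seq T) (S : {set T}).

(** Measure for growing a nonseparable subgraph; edges are counted as well, since a proper extension
    may add no vertex. *)
Definition graph_size K := #|verts K| + #|[set e : T * T | adj K e.1 e.2]|.

Lemma graph_size_max K : graph_size K <= #|T| + #|{: T * T}|.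
Proof. by rewrite leq_add // max_card. Qed.

Lemma subgraph_size H K :
  subgraph H K -> graph_size K <= graph_size H -> subgraph K H.
Proof.
case=> sV sA; rewrite /graph_size => le.
have sE : [set e : T * T | adj H e.1 e.2] \subset [set e : T * T | adj K e.1 e.2].
  by apply/subsetP=> -[a b]; rewrite !inE => /sA.
have leV := subset_leq_card sV; have leE := subset_leq_card sE.
have eV : verts H = verts K by apply/eqP; rewrite eqEcard sV; lia.
have /setP eE : [set e : T * T | adj H e.1 e.2] = [set e : T * T | adj K e.1 e.2].
  by apply/eqP; rewrite eqEcard sE; lia.
split=> [|a b abK]; first by rewrite eV.
by have := eE (a, b); rewrite !inE /= abK.
Qed.

(* Adjacency being decidable, a maximal nonseparable extension of [K] need not
   be produced: failure of maximality of [K] reduces to a larger graph. *)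
Lemma nonseparable_clique G K x y : block_graph G ->
  simple_graph K -> subgraph K G -> nonseparable K ->
  x \in verts K -> y \in verts K -> x != y -> adj G x y.
Proof.
move=> [_ _ blkG]; move: (#|T| + _) graph_size_max => N maxN.
have [m] := ubnP (N - graph_size K).
elim: m K => // m IH K ltm sK subK nsK xK yK xy; apply: contraT => nadj.
suff /blkG/(_ x y xK yK xy) : block G K by case: subK nadj => _ sA /negP nxy /sA.
split=> // K2 sK2 subK2 nsK2 subKK2; have [le|lt] := leqP (graph_size K2) (graph_size K).
  exact: subgraph_size.
have := maxN K2; have [/subsetP sV _] := subKK2 => max2.
case/negP: nadj; apply: (IH K2) => //; [|exact: sV..].
by rewrite -ltnS (leq_trans _ ltm) // ltnS ltn_sub2l // (leq_trans lt).
Qed.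

Lemma path_connect_within (e : rel T) (D : pred T) x p : symmetric e ->
  path e x p -> {subset x :: p <= D} ->
  {in x :: p &, forall y z, connect [rel a b | [&& a \in D, b \in D & e a b]] y z}.
Proof.
move=> se ep sD y z yp zp; set e' := [rel a b | _].
have se' : connect_sym e'.
  by apply: sym_connect_sym => a b /=; rewrite se andbCA.
have p' : path e' x p.
  by apply: (sub_in_path (P := mem (x :: p))) ep;
    [move=> a b ap bp /= ->; rewrite (sD a ap) (sD b bp) | apply/allP].
have c u : u \in x :: p -> connect e' x u by apply: (path_connect p').
by apply: connect_trans (c z zp); rewrite se' c.
Qed.

(** Rotated to start at the deleted vertex, the cycle leaves a path through all the others, so that
    vertex separates none of them. *)
Lemma cycle_nonseparable G p : simple_graph G ->
  ucycle (adj G) p -> p != [::] ->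
  nonseparable (induced G [set x in p]).
Proof.
case=> sG _ aG /andP[cyc up] pn0; split; first split.
- case: p pn0 cyc {up} => // a p _ /next_cycle/(_ (mem_head a p))/aG/andP[aV _].
  by apply/set0Pn; exists a; rewrite !inE aV eqxx.
- move=> x y; rewrite !inE => /andP[_ xp] /andP[_ yp].
  have [k p' def_p] := rot_to xp.
  have: cycle (adj G) (x :: p') by rewrite -def_p rot_cycle.
  rewrite /= rcons_path => /andP[pth _].
  have yp' : y \in x :: p' by rewrite -def_p mem_rot.
  have := @path_connect_within (adj G) (mem [set z in p]) x p' sG pth _ x y (mem_head _ _) yp'.
  by apply=> z; rewrite -def_p mem_rot inE.
move=> v [] /[!inE] /andP[_ vp] [x [y [xv yv _ /negP]]]; apply.
have [k p' def_p] := rot_to vp.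
have: cycle (adj G) (v :: p') by rewrite -def_p rot_cycle.
have: uniq (v :: p') by rewrite -def_p rot_uniq.
have inp z : (z \in p) = (z \in v :: p') by rewrite -def_p mem_rot.
move: xv yv; rewrite !(inE, inp) => /and3P[xv _ xp] /and3P[yv _ yp].
rewrite (negPf xv) in xp; rewrite (negPf yv) in yp.
case: p' => [|a p'] // in inp xp yp def_p *.
rewrite [cycle _ _]/= rcons_path [uniq _]/= => /andP[vnp _] /and3P[_ pth _].
pose D := mem ([set z in p] :\ v).
have := @path_connect_within (adj G) D a p' sG pth _ x y xp yp.
have sD : {subset a :: p' <= D}.
  by move=> z zp; rewrite !inE inp inE zp orbT andbT; apply: contraNneq vnp => <-.
move/(_ sD); apply: connect_sub => b c /=; rewrite !inE => /and3P[/andP[bv bp] /andP[cv cp] bc].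
by apply: connect1; rewrite /= !inE bv cv bp cp bc.
Qed.

(** The path, shortened to a simple one, closes through [v] into a cycle; its vertices induce a
    nonseparable subgraph, hence a clique. *)
Lemma block_graph_triangle G v x y : block_graph G ->
  adj G v x -> adj G v y -> x != y ->
  connect [rel a b | [&& a != v, b != v & adj G a b]] x y -> adj G x y.
Proof.
move=> bG vx vy xy /connectP[p0 pth0 ey].
have [sG _ _] := bG; have [symG irr aG] := sG.
case/shortenP: pth0 ey => p pth up _ ey.
have xv : x != v by apply: contraTneq vx => ->; rewrite irr.
have vp : all (predC1 v) p.
  elim: p x pth {up vx xy xv ey} => //= a p IH x /andP[/and3P[_ av _]] /IH ->.
  by rewrite andbT; exact: av.
have ye : y \in x :: p by rewrite ey mem_last.
have uc : ucycle (adj G) [:: v, x & p].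
  apply/andP; split; last first.
    rewrite cons_uniq up andbT inE negb_or eq_sym xv /=.
    by apply/negP=> /(allP vp); rewrite /= eqxx.
  rewrite /= vx rcons_path -ey [adj G y v]symG vy andbT.
  by apply: sub_path pth => a b /= /and3P[].
have sV z : z \in [:: v, x & p] -> z \in verts G.
  by case/andP: uc => cyc _ /(next_cycle cyc)/aG/andP[].
have ns := cycle_nonseparable sG uc isT.
apply: (nonseparable_clique bG _ _ ns); rewrite ?inE ?eqxx ?orbT ?xy //=.
- split=> [a b|a|a b] /=; first by rewrite symG andbCA.
    by rewrite irr !andbF.
  by case/and3P=> ap bp ab; rewrite !in_setI ap bp !sV //; [move: bp | move: ap]; rewrite inE.
- by split=> [|a b /and3P[] //]; apply: subsetIl.
- by rewrite sV // !inE eqxx orbT.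
- by move: ye; rewrite inE => ye; rewrite sV ?inE ye ?orbT.
Qed.

End BlockGraph.

(** * Layerings *)

Section Layering.
Variables (T : finType) (G : graph T) (root : T) (d : T -> nat) (par : T -> T).

(** These local conditions force [d] to be the distance from [root]: the second bounds it above by
    the distance, and the chain of parents is a path of length [d x]. *)
Definition layering : Prop :=
  [/\ d root = 0,
      forall x y, adj G x y -> d y <= (d x).+1
    & forall x, x != root -> adj G x (par x) /\ d x = (d (par x)).+1].

Hypotheses (bG : block_graph G) (L : layering).

Lemma graph_sym : symmetric (adj G). Proof. by case: bG => -[]. Qed.
Lemma graph_irr : irreflexive (adj G). Proof. by case: bG => -[]. Qed.

Lemma adj_neq x y : adj G x y -> x != y.
Proof. by apply: contraTneq => ->; rewrite graph_irr. Qed.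

Lemma depth_root : d root = 0. Proof. by case: L. Qed.

Lemma adj_depth x y : adj G x y -> d y <= (d x).+1.
Proof. by case: L => _ + _; apply. Qed.

Lemma adj_par x : x != root -> adj G x (par x).
Proof. by move=> xr; case: L => _ _ /(_ x xr)[]. Qed.

Lemma depth_par x : x != root -> d x = (d (par x)).+1.
Proof. by move=> xr; case: L => _ _ /(_ x xr)[]. Qed.

Lemma depth_gt0 x : (0 < d x) = (x != root).
Proof.
by apply/idP/idP => [|/depth_par ->//]; apply: contraTneq => ->; rewrite depth_root.
Qed.

(** Proper ancestors of [x] are strictly above the level of [v], so the chain of parents never meets
    [v]. *)
Lemma connect_root_avoiding v x : x != v -> d x <= d v ->
  connect [rel a b | [&& a != v, b != v & adj G a b]] x root.
Proof.
have [m] := ubnP (d x); elim: m x => // m IH x; rewrite ltnS => dm xv dv.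
have [->|xr] := eqVneq x root; first exact: connect0.
have dp := depth_par xr; have pv : par x != v by apply: contraTneq dv => <-; lia.
apply: (connect_trans (y := par x)); last by apply: IH => //; lia.
by apply: connect1; rewrite /= xv pv adj_par.
Qed.

Lemma connect_avoiding v x y : x != v -> d x <= d v -> y != v -> d y <= d v ->
  connect [rel a b | [&& a != v, b != v & adj G a b]] x y.
Proof.
move=> xv dx yv dy; apply: connect_trans (connect_root_avoiding xv dx) _.
rewrite sym_connect_sym; first exact: connect_root_avoiding.
by move=> a b /=; rewrite graph_sym andbCA.
Qed.

(** Were [y] a second upper neighbour, the walk from [x] via [par x] and the root to [par y] would
    avoid [y], making [x] adjacent to [par y] two levels above. *)
Lemma par_unique x y : adj G x y -> d x = (d y).+1 -> y = par x.
Proof.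
move=> xy dxy; apply/eqP; apply: contraT => nyp.
have xr : x != root by rewrite -depth_gt0 dxy.
have dx := depth_par xr; have px := adj_par xr.
have yr : y != root.
  apply: contraNneq nyp => ye; have : ~~ (0 < d (par x)) by rewrite ye depth_root in dxy; lia.
  by rewrite depth_gt0 negbK ye eq_sym.
have dy := depth_par yr; have py := adj_par yr.
have xpy : x != par y by apply/eqP=> /(congr1 d); lia.
have : adj G x (par y).
  apply: (block_graph_triangle bG (v := y)); rewrite // 1?graph_sym //.
  apply: (connect_trans (y := par x)).
    by apply: connect1; rewrite /= adj_neq // eq_sym nyp px.
  apply: connect_avoiding; rewrite 1?eq_sym //; try lia.
  by rewrite adj_neq.
by rewrite graph_sym => /adj_depth; lia.
Qed.

(** The walk from [y] via [par y] to [par x] avoids [x], so [y] is adjacent to [par x], and upper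
    neighbours are unique. *)
Lemma par_level x y : adj G x y -> d x = d y -> par x = par y.
Proof.
move=> xy dxy.
have xr : x != root.
  apply: contraTneq xy => xe; move: dxy; rewrite xe depth_root => dy.
  have : ~~ (0 < d y) by rewrite -dy.
  by rewrite depth_gt0 negbK => /eqP ->; rewrite graph_irr.
have yr : y != root by rewrite -depth_gt0 -dxy depth_gt0.
have dx := depth_par xr; have px := adj_par xr.
have dy := depth_par yr; have py := adj_par yr.
have ypx : y != par x by apply/eqP=> /(congr1 d); lia.
apply: par_unique; last lia.
apply: (block_graph_triangle bG (v := x)); rewrite //.
apply: (connect_trans (y := par y)).
  apply: connect1; rewrite /= py andbT eq_sym adj_neq //=.
  by apply/eqP=> /(congr1 d); lia.
apply: connect_avoiding; try lia; first by apply/eqP=> /(congr1 d); lia.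
by rewrite eq_sym adj_neq.
Qed.

Lemma adj_level_trans y x z : adj G x y -> adj G y z -> d x = d y -> d y = d z ->
  x != z -> adj G x z.
Proof.
move=> xy yz dxy dyz xz; rewrite graph_sym in xy.
have pxy := par_level xy (esym dxy); have pyz := par_level yz dyz.
have yr : y != root.
  apply: contraTneq yz => ye; move: dyz; rewrite ye depth_root => dz.
  have : ~~ (0 < d z) by rewrite -dz.
  by rewrite depth_gt0 negbK => /eqP ->; rewrite graph_irr.
have dy := depth_par yr.
have xr : x != root by rewrite -depth_gt0 dxy depth_gt0.
have zr : z != root by rewrite -depth_gt0 -dyz depth_gt0.
apply: (block_graph_triangle bG (v := y)); rewrite //.
have nyp u : u = y -> par y != u by move=> ->; apply/eqP=> /(congr1 d); lia.
apply: (connect_trans (y := par y)); apply: connect1; rewrite /= nyp // ?andbT /=.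
  by rewrite eq_sym adj_neq //= pxy adj_par.
by rewrite eq_sym adj_neq //= pyz graph_sym adj_par.
Qed.

(** * Covering by edges *)

Definition cl x y := (x == y) || adj G x y.
Definition covers (e : T * T) x := cl x e.1 || cl x e.2.
Definition dom (S : {set T}) x := [exists y in S, cl x y].
(** The edges of [A] may repeat, overlap or meet [S], so an exchange never has to restore
    disjointness. *)
Definition ext (S : {set T}) k := exists2 A : seq (T * T),
  size A = k /\ {in A, forall e, adj G e.1 e.2}
  & forall x, dom S x || has (covers^~ x) A.

Lemma domP (S : {set T}) x : reflect (exists2 y, y \in S & cl x y) (dom S x).
Proof. exact: exists_inP. Qed.

Lemma domS (S S' : {set T}) x : S \subset S' -> dom S x -> dom S' x.
Proof.
by move=> /subsetP sS /domP[y /sS yS xy]; apply/domP; exists y.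
Qed.

(* One edge is spent whenever every edge covering some undominated vertex
   covers nothing that [S'] does not dominate. *)
Lemma ext_drop (S S' : {set T}) k v : S \subset S' -> ~~ dom S v ->
  (forall e x, adj G e.1 e.2 -> covers e v -> covers e x -> ~~ dom S x -> dom S' x) ->
  ext S k -> exists2 k', k = k'.+1 & ext S' k'.
Proof.
move=> sS nv H [A [sA aA] cA].
have /hasP[e eA ev] : has (covers^~ v) A by have := cA v; rewrite (negPf nv).
exists (size (rem e A)); first by rewrite size_rem // prednK // -?sA //; case: A eA {sA aA cA}.
exists (rem e A); first by split=> // f /mem_rem /aA.
move=> x; have [dx|ndx] := boolP (dom S x); first by rewrite (domS sS dx).
have := cA x; rewrite (negPf ndx) (perm_has _ (perm_to_rem eA)) /=.
by case/orP=> [ex|->]; rewrite ?orbT // (H e) ?aA.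
Qed.

(** For [p] other than the root, this is the block containing [p] and its parent. *)
Definition upper_clique p : {set T} :=
  [set s | (s == par p) || cl p s && (d s == d p)].

Lemma upper_clique_adj p s t : p != root ->
  s \in upper_clique p -> t \in upper_clique p -> s != t -> adj G s t.
Proof.
move=> pr.
have lev u : cl p u && (d u == d p) -> par u = par p.
  case/andP=> /predU1P[-> //|pu] /eqP du; exact/esym/par_level.
have nr u : cl p u && (d u == d p) -> u != root.
  by case/andP=> _ /eqP du; rewrite -depth_gt0 du depth_gt0.
rewrite !inE => /orP[/eqP->|hs] /orP[/eqP->|ht]; first by rewrite eqxx.
- by move=> _; rewrite -(lev t ht) graph_sym adj_par ?nr.
- by move=> _; rewrite -(lev s hs) adj_par ?nr.
case/andP: hs => /predU1P[<-|ps] /eqP ds; case/andP: ht => /predU1P[<-|pt] /eqP dt //.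
- by rewrite eqxx.
- by rewrite graph_sym.
by apply: (adj_level_trans _ pt); rewrite // graph_sym.
Qed.

Section Undominated.
Variables (U : pred T) (v : T).
Hypotheses (vr : v != root) (maxU : forall x, U x -> d x <= d v).
Let p := par v.
(** Here [U] stands for the undominated vertices: replacing a good [z] by [p] loses none of them. *)
Let good z := forall x, U x -> cl x z -> cl x p.

Lemma good_sibling z : z != root -> d z = d v -> par z = p -> good z.
Proof.
move=> zr dz pz x Ux; case/predU1P=> [->|xz].
  by rewrite /cl -pz adj_par // orbT.
have dx := maxU Ux; have dxz := adj_depth xz.
case: (ltngtP (d x) (d v)) => [lt||eq]; [|lia|].
  have zx : adj G z x by rewrite graph_sym.
  by rewrite (par_unique zx) ?pz ?/cl ?eqxx //; lia.
have pxz := par_level xz (etrans eq (esym dz)).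
by rewrite /cl -pz -pxz adj_par ?orbT // -depth_gt0 eq depth_gt0.
Qed.

Lemma good_child z : d z = (d v).+1 -> par (par z) = p -> good z.
Proof.
move=> dz ppz x Ux xz; have dx := maxU Ux.
have zr : z != root by rewrite -depth_gt0 dz.
have dpz := depth_par zr.
case/predU1P: xz dx => [->|xz dx]; first lia.
have zx : adj G z x by rewrite graph_sym.
have dzx := adj_depth zx; have dxz := adj_depth xz.
rewrite (par_unique zx) -?ppz; last lia.
by rewrite /cl adj_par ?orbT // -depth_gt0; move: vr; rewrite -depth_gt0; lia.
Qed.

Lemma good_deep z : d v + 2 <= d z -> good z.
Proof.
move=> dz x Ux; have dx := maxU Ux.
by case/predU1P=> [xz|/adj_depth]; [move: dx; rewrite xz|]; lia.
Qed.

Lemma good_near a : cl v a -> good a.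
Proof.
case/predU1P=> [<-|va]; first exact: good_sibling.
have av : adj G a v by rewrite graph_sym.
have dva := adj_depth va; have dav := adj_depth av.
case: (ltngtP (d a) (d v)) => [lt|gt|eq].
- by rewrite (par_unique va) //; lia.
- have da : d a = (d v).+1 by lia.
  by apply: good_child => //; rewrite -(par_unique av da).
by apply: good_sibling => //; [rewrite -depth_gt0 eq depth_gt0 | exact/esym/par_level].
Qed.

(** If [a] is not [p], it is a sibling or child of [v] or [v] itself, and all its neighbours are
    good. If [a] is [p], only its children are good; the remaining neighbours form its block
    upwards, absent when [p] is the root. *)
Lemma good_or_clique a b : cl v a -> adj G a b ->
  good b \/ p != root /\ b \in upper_clique p.
Proof.
move=> va ab; have ba : adj G b a by rewrite graph_sym.
have dab := adj_depth ab; have dba := adj_depth ba.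
have dv := depth_par vr.
have da : (a == p) || (d v <= d a).
  case/predU1P: va => [<-|va]; first by rewrite leqnn orbT.
  case: (leqP (d v) (d a)) => lt; first by rewrite orbT.
  have av : adj G a v by rewrite graph_sym.
  by have := adj_depth av => dva; rewrite (par_unique va) ?eqxx //; lia.
have dav : d a <= (d v).+1 by case/predU1P: va => [->//|/adj_depth].
have ndb : d b = d v -> b != root by move=> e; rewrite -depth_gt0 e depth_gt0.
have nda : d a = d v -> a != root by move=> e; rewrite -depth_gt0 e depth_gt0.
have vpa : d a = d v -> par a = p.
  move=> e; case/predU1P: va => [<-//|va]; exact/esym/par_level.
have vca : d a = (d v).+1 -> par a = v.
  move=> e; case/predU1P: va => [va|va]; first by rewrite -va in e; lia.
  by apply/esym/par_unique; rewrite // graph_sym.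
case/orP: da => [/eqP ap|da].
  rewrite {a va dav ndb nda vpa vca}ap -/p in ab ba dab dba dv *.
  have [pr|pr] := eqVneq p root.
    have e : d b = d v.
      suff : 0 < d b by rewrite dv pr depth_root in dab *; lia.
      by rewrite depth_gt0 -pr adj_neq.
    left; apply: good_sibling; rewrite // -?depth_gt0 ?e ?depth_gt0 //.
    by rewrite -(par_unique ba) //; lia.
  case: (ltngtP (d b) (d p)) => [lt|gt|eq].
  - by right; rewrite inE (par_unique ab) ?eqxx //; lia.
  - left; apply: good_sibling; rewrite // -?depth_gt0; try lia.
    by rewrite -(par_unique ba) //; lia.
  - by right; rewrite inE /cl ab eq eqxx !orbT.
left; have [db|db] := leqP (d v + 2) (d b); first exact: good_deep.
case: (ltngtP (d b) (d v)) => [lt|gt|eq].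
- have e : d a = d v by lia.
  by rewrite (par_unique ab) ?vpa //; lia.
- have e : d b = (d v).+1 by lia.
  apply: good_child => //; case: (ltngtP (d a) (d v)) => [|gta|eqa]; first lia.
    have ea : d a = (d v).+1 by lia.
    by rewrite -(par_level ab) ?vca //; lia.
  by rewrite -(par_unique ba) ?vpa //; lia.
- apply: good_sibling => //; first exact: ndb.
  case: (ltngtP (d a) (d v)) => [|gta|eqa]; first lia.
    have ea : d a = (d v).+1 by lia.
    by rewrite (par_unique ab) ?vca //; lia.
  by rewrite -(par_level ab) ?vpa //; lia.
Qed.

Lemma covers_cases e : adj G e.1 e.2 -> covers e v ->
  (forall x, U x -> covers e x -> cl x p) \/
  (p != root /\ exists2 s, s \in upper_clique p &
      forall x, U x -> covers e x -> cl x p || cl x s).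
Proof.
case: e => a b /= ab; rewrite /covers /=.
wlog va : a b ab / cl v a => [hw|_].
  case/orP=> [va|vb]; first by apply: hw => //; rewrite va.
  have ba : adj G b a by rewrite graph_sym.
  have bv : cl v b || cl v a by rewrite vb.
  case: (hw b a ba vb bv) => [h|[pr [s sp h]]].
    by left=> x Ux /=; rewrite orbC; apply: h.
  by right; split=> //; exists s => // x Ux /=; rewrite orbC; apply: h.
have ga := good_near va; have [gb|[pr bp]] := good_or_clique va ab.
  by left=> x Ux /orP[]; [apply: ga | apply: gb].
by right; split=> //; exists b => // x Ux /orP[/(ga x Ux)->|->]; rewrite ?orbT.
Qed.

End Undominated.

(* Two edges covering [v] and [v'] separately may be traded for [p q] and an
   edge of the clique above [p] and [q]. *)
Lemma ext_pair (S : {set T}) k v v' :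
  let p := par v in let q := par v' in
  v != root -> v' != root -> d v' = d v -> adj G p q ->
  ~~ dom S v -> ~~ dom S v' -> (forall x, ~~ dom S x -> d x <= d v) ->
  ext S k -> exists2 k', k = k'.+1 & ext (p |: (q |: S)) k'.
Proof.
move=> p q vr vr' dv' pq nv nv' maxv.
have maxv' x : ~~ dom S x -> d x <= d v' by rewrite dv'; apply: maxv.
set S' := p |: _.
have sS : S \subset S' by apply/subsetP=> x xS; rewrite !inE xS !orbT.
have domp x : cl x p -> dom S' x by move=> xp; apply/domP; exists p; rewrite // !inE eqxx.
have domq x : cl x q -> dom S' x by move=> xq; apply/domP; exists q; rewrite // !inE eqxx orbT.
have dp := depth_par vr; have dq := depth_par vr'.
have npq := adj_neq pq; have qp : adj G q p by rewrite graph_sym.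
(* An end near [v] is good for [p]; it cannot also be near [v'], which is not adjacent to [p]. The
   other end is therefore near [v'] and good for [q]. *)
have both e : adj G e.1 e.2 -> covers e v -> covers e v' ->
    forall x, ~~ dom S x -> covers e x -> dom S' x.
  have far x y : x != root -> y != root -> d x = d y -> par x != par y -> ~~ cl x (par y).
    move=> xr yr dxy; apply: contra => /predU1P[xy|xy].
      by have dy := depth_par yr; rewrite xy dy in dxy; case: (n_Sn _ dxy).
    by rewrite (par_unique xy) // dxy depth_par.
  case: e => a b /= ab; rewrite /covers /=.
  wlog va : a b ab / cl v a => [hw|_].
    have ba : adj G b a by rewrite graph_sym.
    case/orP=> [va|vb]; first by apply: hw; rewrite ?va.
    by rewrite orbC => h x nx; rewrite orbC; apply: (hw b a); rewrite ?vb.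
  have ga := good_near (U := [pred x | ~~ dom S x]) vr maxv va.
  case/orP=> [v'a|v'b x nx].
    by have := ga v' nv' v'a; rewrite (negPf (far _ _ _ _ _ _)) // eq_sym.
  case/orP=> [/(ga x nx)/domp//|].
  by move/(good_near (U := [pred x | ~~ dom S x]) vr' maxv' v'b nx)/domq.
move=> extS; case: (extS) => A [sA aA] cA.
have /hasP[e eA ev] : has (covers^~ v) A by have := cA v; rewrite (negPf nv).
have /hasP[f fA fv] : has (covers^~ v') A by have := cA v'; rewrite (negPf nv').
(* One edge serving both vertices is simply dropped; two edges are merged into a single edge of the
   block above [p] and [q]. *)
have [eqef|nef] := eqVneq e f.
  exists (size (rem e A)); first by rewrite size_rem // prednK // -?sA //; case: A eA {sA aA cA fA}.
  exists (rem e A); first by split=> // g /mem_rem /aA.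
  move=> x; have [dx|ndx] := boolP (dom S x); first by rewrite (domS sS dx).
  have := cA x; rewrite (negPf ndx) (perm_has _ (perm_to_rem eA)) /=.
  by case/orP=> [ex|->]; rewrite ?orbT // (both e) ?aA // eqef.
have fA' : f \in rem e A.
  by move: fA; rewrite (perm_mem (perm_to_rem eA)) inE eq_sym (negPf nef).
have dpq : d p = d q by apply: succn_inj; rewrite -dp -dq dv'.
have pr : p != root.
  by apply: contraNneq npq => pe; rewrite pe eq_sym -[_ == _]negbK -depth_gt0 -dpq pe depth_root.
have eqU : upper_clique q = upper_clique p.
  apply/setP=> s; rewrite !inE (par_level pq dpq) -dpq; congr (_ || _).
  have [ds|_] := eqVneq (d s) (d p); last by rewrite !andbF.
  rewrite !andbT /cl; apply/idP/idP => /predU1P[<-|h]; rewrite ?pq ?qp ?orbT //.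
    case: eqVneq => //= ps; apply: (adj_level_trans pq h); rewrite // ?ds //.
  case: eqVneq => //= ps; apply: (adj_level_trans qp h); rewrite // ?ds //.
have cov g u : adj G g.1 g.2 -> (u = v \/ u = v') -> covers g u ->
    exists2 s, s \in upper_clique p &
      forall x, ~~ dom S x -> covers g x -> dom S' x || cl x s.
  move=> ag uv gu; have pp : par p \in upper_clique p by rewrite inE eqxx.
  case: uv gu => -> gu.
    case: (covers_cases (U := [pred x | ~~ dom S x]) vr maxv ag gu) => [h|[_ [s sp h]]].
      by exists (par p) => // x nx gx; rewrite domp //; apply: h.
    by exists s => // x nx gx; case/orP: (h x nx gx) => [/domp->|->]; rewrite ?orbT.
  case: (covers_cases (U := [pred x | ~~ dom S x]) vr' maxv' ag gu) => [h|[_ [s sp h]]].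
    by exists (par p) => // x nx gx; rewrite domq //; apply: h.
  by exists s; rewrite -?eqU // => x nx gx; case/orP: (h x nx gx) => [/domq->|->]; rewrite ?orbT.
have [s sp hs] := cov e v (aA e eA) (or_introl erefl) ev.
have [t tp ht] := cov f v' (aA f fA) (or_intror erefl) fv.
(* If the two block vertices coincide they do not form an edge, and any edge at that vertex will
   do. *)
have [g ag gst] : exists2 g : T * T, adj G g.1 g.2 & forall x, cl x s || cl x t -> covers g x.
  have [<-|nst] := eqVneq s t; last first.
    by exists (s, t) => //=; apply: upper_clique_adj sp tp nst.
  have [y sy] : exists y, adj G s y.
    have [->|sp'] := eqVneq s p; first by exists q.
    have pU : p \in upper_clique p by rewrite inE /cl !eqxx orbT.
    by exists p; apply: upper_clique_adj sp pU sp'.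
  by exists (s, y) => //= x; rewrite orbb /covers /= => ->.
exists (size (g :: rem f (rem e A))).
  rewrite /= -sA (perm_size (perm_to_rem eA)) /= (perm_size (perm_to_rem fA')) //.
exists (g :: rem f (rem e A)).
  by split=> // h; rewrite inE => /predU1P[->//|/mem_rem/mem_rem/aA].
move=> x; have [dx|ndx] := boolP (dom S x); first by rewrite (domS sS dx).
have := cA x; rewrite (negPf ndx) (perm_has _ (perm_to_rem eA)) /=.
rewrite (perm_has _ (perm_to_rem fA')) /=.
case/or3P=> [/(hs x ndx)|/(ht x ndx)|->]; rewrite ?orbT //; case/orP=> [->//|xs];
  by rewrite (gst x) ?xs ?orbT.
Qed.

(** A same-level neighbour [s] of [p] covers beyond [p] and [par p] only its children, and the
    fourth premise says that none of those is undominated. Only membership of [p] and [par p] in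
    [S'] is asked, so the lemma serves both for pairing [p] with its parent and for pairing it with
    a child. *)
Lemma ext_parent (S S' : {set T}) k v :
  let p := par v in v != root -> ~~ dom S v -> (forall x, ~~ dom S x -> d x <= d v) ->
  (forall x, x != root -> ~~ dom S x -> d x = d v -> adj G p (par x) -> False) ->
  S \subset S' -> p \in S' -> (p != root -> par p \in S') ->
  ext S k -> exists2 k', k = k'.+1 & ext S' k'.
Proof.
move=> p vr nv maxv nosib sS pS' ppS'; apply: (ext_drop sS nv) => e x ae ev ex nx.
have domp y : cl y p -> dom S' y by move=> yp; apply/domP; exists p.
case: (covers_cases (U := [pred x | ~~ dom S x]) vr maxv ae ev) => [h|[pr [s sp h]]].
  by apply: domp; apply: h.
case/orP: (h x nx ex) => [/domp//|xs].
have dompp y : cl y (par p) -> dom S' y by move=> yp; apply/domP; exists (par p); rewrite ?ppS'.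
move: sp; rewrite inE => /predU1P[sp|/andP[ps /eqP ds]]; first by apply: dompp; rewrite -sp.
case/predU1P: ps => [ps|ps]; first by apply: domp; move: xs; rewrite -ps.
have psp : par p = par s by apply: par_level.
have sr : s != root by rewrite -depth_gt0 ds depth_gt0.
case/predU1P: xs => [->|xs]; first by apply: dompp; rewrite psp /cl adj_par ?orbT.
have sx : adj G s x by rewrite graph_sym.
have dxs := adj_depth xs; have dsx := adj_depth sx; have dv := depth_par vr.
case: (ltngtP (d x) (d s)) => [lt|gt|eq].
- by apply: dompp; rewrite psp -(par_unique sx) /cl ?eqxx //; clear - lt dsx dxs; lia.
- have dx : d x = (d s).+1 by clear - gt dsx dxs; lia.
  have xr : x != root by rewrite -depth_gt0 dx.
  by case: (nosib x); rewrite -?(par_unique xs dx) // dx ds -/p dv.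
by apply: dompp; rewrite psp -(par_level xs eq) /cl adj_par ?orbT // -depth_gt0 eq depth_gt0.
Qed.

Lemma ext_root (S S' : {set T}) k : ~~ dom S root ->
  (forall x, ~~ dom S x -> x = root) -> S \subset S' -> root \in S' ->
  ext S k -> exists2 k', k = k'.+1 & ext S' k'.
Proof.
move=> nr onlyr sS rS'; apply: (ext_drop sS nr) => e x _ _ _ /onlyr ->.
by apply/domP; exists root; rewrite // /cl eqxx.
Qed.

End Layering.

(** * Matched sets *)

Section Pairing.
Variables (T : finType) (G : graph T).
Hypotheses (sG : simple_graph G) (vG : verts G = setT).

Definition matched (S : {set T}) := exists M, perfect_matching (induced G S) M.

Lemma matched0 : matched set0.
Proof.
exists set0; split; first exact: sub0set.
rewrite /= setI0 /partition /cover big_set0 eqxx inE andbT.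
by apply/trivIsetP=> A B; rewrite inE.
Qed.

Lemma matchedU2 (S : {set T}) x y :
  adj G x y -> x \notin S -> y \notin S -> matched S -> matched (x |: (y |: S)).
Proof.
move=> xy xS yS [M [sM pM]]; rewrite /= vG setTI in pM.
exists ([set x; y] |: M); split.
  rewrite subUset sub1set; apply/andP; split.
    by apply/imsetP; exists (x, y) => //; rewrite inE; apply/and3P; split; rewrite /= ?inE ?eqxx ?orbT.
  apply: subset_trans sM _; apply/subsetP=> _ /imsetP[[a b] + ->]; rewrite inE => /and3P[/= aS bS ab].
  by apply/imsetP; exists (a, b) => //; rewrite inE; apply/and3P; split; rewrite /= ?inE ?aS ?bS ?orbT.
rewrite /= vG setTI setUA; apply: partitionU1 => //.
  by apply/set0Pn; exists x; rewrite !inE eqxx.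
by rewrite disjoints_subset subUset !sub1set !inE xS yS.
Qed.

Lemma matched_edges (S : {set T}) : matched S ->
  exists2 A : seq (T * T), (size A).*2 = #|S| /\ {in A, forall e, adj G e.1 e.2}
    & forall x, x \in S -> exists2 e, e \in A & (x == e.1) || (x == e.2).
Proof.
case=> M [/subsetP sM]; rewrite /= vG setTI => pM.
have [A szA [aA sA]] : exists2 A : seq (T * T), size A = #|M| &
    {in A, forall e, adj G e.1 e.2} /\
    forall B, B \in M -> exists2 e, e \in A & B = [set e.1; e.2].
  rewrite cardE; suff: {subset enum M <= M} -> exists2 A : seq (T * T), size A = size (enum M) &
      {in A, forall e, adj G e.1 e.2} /\
      forall B, B \in enum M -> exists2 e, e \in A & B = [set e.1; e.2].
    case=> [B|A sz [aA sA]]; first by rewrite mem_enum.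
    by exists A => //; split=> // B BM; apply: sA; rewrite mem_enum.
  elim: (enum M) => [|B s IH] sub; first by exists [::].
  have [C Cs|A szA [aA sA]] := IH; first by rewrite sub // inE Cs orbT.
  have /sM/imsetP[e + Be] := sub B (mem_head _ _); rewrite inE => /and3P[_ _ ae].
  exists (e :: A); rewrite /= ?szA //; split=> [f|C].
    by rewrite inE => /predU1P[->//|/aA].
  rewrite inE => /predU1P[->|/sA[f fA ->]]; last by exists f; rewrite // inE fA orbT.
  by exists e; rewrite ?mem_head.
exists A; first split=> //.
  rewrite (card_uniform_partition (n := 2) _ pM) ?szA ?muln2 // => B /sA[e /aA ae ->].
  by rewrite cards2; case: eqP ae => // ->; case: sG => _ ->.
move=> x; rewrite -(cover_partition pM) => /bigcupP[B /sA[e eA ->] xe].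
by exists e => //; move: xe; rewrite !inE.
Qed.

(** Source of the lower bound: the matching edges are a feasible solution of the relaxed problem. *)
Lemma paired_dominating_ext (S : {set T}) :
  paired_dominating G S -> exists2 k, k.*2 = #|S| & ext G set0 k.
Proof.
case=> _ domS /matched_edges[A [szA aA] covA]; exists (size A) => //.
exists A => // x; apply/orP; right.
have [y yS xy] : exists2 y, y \in S & cl G x y.
  have [xS|xS] := boolP (x \in S); first by exists x; rewrite // /cl eqxx.
  have [|y yS xy] := domS x _ xS; first by rewrite vG inE.
  by exists y; rewrite // /cl xy orbT.
have [e eA ye] := covA y yS; apply/hasP; exists e => //.
by rewrite /covers; case/orP: ye xy => /eqP -> ->; rewrite ?orbT.
Qed.

Lemma minimum_of_ext (S : {set T}) : matched S -> (forall x, dom G S x) ->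
  (forall k, ext G set0 k -> #|S| <= k.*2) -> minimum_paired_dominating G S.
Proof.
move=> mS dS minS; split=> [|D /paired_dominating_ext[k <- /minS//]].
split=> //; first by rewrite vG subsetT.
by move=> x _ xS; case/exists_inP: (dS x) => y yS /predU1P[xy|]; [rewrite xy yS in xS | exists y].
Qed.

End Pairing.

(** * The greedy invariant *)

Section Greedy.
Variables (T : finType) (G : graph T) (root : T) (d : T -> nat) (par : T -> T) (q : seq T).
Hypotheses (bG : block_graph G) (vG : verts G = setT) (L : layering G root d par).
Hypotheses (q_all : forall x, x \in q).
Hypothesis q_sorted : forall x y, index x q <= index y q -> d x <= d y.
Implicit Types (S : {set T}) (wit : T -> option T).
Local Notation idx x := (index x q).
Local Notation dom := (dom G).
Local Notation ext := (ext G).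

Let sG : simple_graph G. Proof. by case: bG. Qed.

(* [wit b] is an undominated child of [b], if one is known. Vertices of index
   at least [i] have been examined for domination, and for those of index at
   least [j] the children have been dominated. *)
Record greedy_inv (i j : nat) S wit : Prop := GreedyInv {
  inv_matched : matched G S;
  inv_ext : forall k, ext set0 k -> exists2 k', ext S k' & #|S| + k'.*2 <= k.*2;
  inv_wit : forall b x, wit b = Some x -> [/\ par x = b, x != root & i <= idx x];
  inv_wit_dom : forall b x, wit b = Some x -> b \notin S -> ~~ dom S x /\ idx b < j;
  inv_undom : forall x, ~~ dom S x -> i <= idx x -> x != root -> wit (par x) != None;
  inv_depth : forall x b, i <= idx x -> idx b < j -> d b < d x;
  inv_level : forall x b, j <= idx b -> idx x < i -> d x <= d b }.

Lemma index_inj : injective (index^~ q).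
Proof. by move=> x y e; rewrite -(nth_index x (q_all x)) e nth_index. Qed.

Lemma greedy_init : greedy_inv (size q) (size q) set0 (fun=> None).
Proof.
have ltq x : idx x < size q by rewrite index_mem.
split=> //; first exact: matched0.
- by move=> k ek; exists k; rewrite ?cards0.
- by move=> x _; rewrite leqNgt ltq.
- by move=> x b; rewrite leqNgt ltq.
- by move=> x b; rewrite leqNgt ltq.
Qed.

Lemma undominated_par S x : ~~ dom S x -> x != root -> par x \notin S.
Proof.
move=> nx xr; apply: contra nx => pS; apply/domP; exists (par x) => //.
by rewrite /cl (adj_par L) ?orbT.
Qed.

Lemma greedy_flush_skip i j S wit p : idx p = j ->
  (forall x, idx x < i -> d x <= d p) -> (wit p != None -> p \in S) ->
  greedy_inv i j.+1 S wit -> greedy_inv i j S wit.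
Proof.
move=> ip maxp pS [I1 I2 I3 I4 I5 I6 I7]; split=> //.
- move=> b x wb nb; have [nx] := I4 b x wb nb; rewrite ltnS leq_eqVlt => /predU1P[|//].
  rewrite -ip => /index_inj eb; move: pS; rewrite -eb wb => /(_ isT).
  by rewrite (negPf nb).
- by move=> x b ix ib; apply: I6; rewrite // ltnW.
- move=> x b; rewrite leq_eqVlt => /predU1P[e|ib]; last exact: I7.
  by have -> : b = p; [apply: index_inj; rewrite ip | apply: maxp].
Qed.

(** The order of preference matters: absence of a sibling is what [ext_parent] needs in the last two
    cases. [Child] also covers [p] being the root, which has no parent to pair with. *)
Inductive partner S wit p v : T -> Prop :=
| Sibling y of adj G p y & d y = d p & y \notin S & wit y != None : partner S wit p v y
| Parent of (forall y, adj G p y -> d y = d p -> y \notin S -> wit y = None)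
    & p != root & par p \notin S : partner S wit p v (par p)
| Child of (forall y, adj G p y -> d y = d p -> y \notin S -> wit y = None)
    & (p != root -> par p \in S) : partner S wit p v v.

Lemma greedy_flush i j S wit p v y : idx p = j ->
  (forall x, idx x < i -> d x <= d p) -> wit p = Some v -> p \notin S ->
  partner S wit p v y ->
  greedy_inv i j.+1 S wit -> greedy_inv i j (p |: (y |: S)) wit.
Proof.
move=> ip maxp wp pS Py [I1 I2 I3 I4 I5 I6 I7]; set S' := p |: _.
have [pv vr iv] := I3 _ _ wp; have [nv _] := I4 _ _ wp pS.
have dv : d v = (d p).+1 by rewrite (depth_par L vr) pv.
have sS : S \subset S' by apply/subsetP=> z zS; rewrite !inE zS !orbT.
have ndS z : ~~ dom S' z -> ~~ dom S z by apply: contra; apply: domS.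
have wS z : ~~ dom S z -> z != root -> d z = d v -> par z \notin S /\ wit (par z) != None.
  move=> nz zr dz; split; first exact: undominated_par.
  apply: I5 => //; rewrite leqNgt; apply: contraTN isT => /maxp.
  by rewrite dz dv ltnn.
(* An unexamined vertex is no deeper than [p]; an examined one left a witness at its parent, which
   is then still to be served and hence no deeper than [p]. *)
have maxv z : ~~ dom S z -> d z <= d v.
  move=> nz; have [lt|iz] := ltnP (idx z) i; first by rewrite dv (leq_trans (maxp _ lt)).
  have [->|zr] := eqVneq z root; first by rewrite (depth_root L).
  case wz : (wit (par z)) (I5 z nz iz zr) => [u|//] _.
  have [_] := I4 _ _ wz (undominated_par nz zr).
  by rewrite (depth_par L zr) dv ltnS -ip => /q_sorted.
have vS : v \notin S by apply: contra nv => vS; apply/domP; exists v; rewrite // /cl eqxx.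
have [ay yS] : adj G p y /\ y \notin S.
  case: Py => [z||] //; first by move=> _ pr; rewrite (adj_par L).
  by rewrite -pv (graph_sym bG) (adj_par L).
have py := adj_neq bG ay.
have cS' : #|S'| = #|S| + 2.
  by rewrite !cardsU1 !inE (negPf py) (negPf pS) yS addnA addnC.
split.
- exact: matchedU2.
- move=> k /I2[k' ek' le].
  suff [k'' ? ek''] : exists2 k'', k' = k''.+1 & ext S' k''.
    by exists k''; rewrite // cS'; lia.
  have nosib (H : forall y, adj G p y -> d y = d p -> y \notin S -> wit y = None) z :
      z != root -> ~~ dom S z -> d z = d v -> adj G (par v) (par z) -> False.
    move=> zr nz dz; rewrite pv => apz; have [zS wz] := wS z nz zr dz.
    by rewrite (H _ apz) // in wz; apply: succn_inj; rewrite -(depth_par L zr) dz.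
  case: Py ay yS @S' sS {ndS cS'} => [z az dz zS wz|H pr ppS|H ppS] ay yS S' sS.
  + case wv' : (wit z) wz => [v'|//] _.
    have [pv' vr' _] := I3 _ _ wv'; have [nv' _] := I4 _ _ wv' zS.
    have := @ext_pair T G root d par bG L S k' v v'; rewrite /= pv pv'; apply=> //.
    by rewrite (depth_par L vr') pv' dz dv.
  + apply: (ext_parent bG L vr nv maxv (nosib H) sS _ _ ek'); rewrite pv ?inE ?eqxx //.
    by rewrite orbT.
  + apply: (ext_parent bG L vr nv maxv (nosib H) sS _ _ ek'); rewrite pv ?inE ?eqxx //.
    by move=> /ppS ->; rewrite !orbT.
- exact: I3.
- move=> b x wb bS'; have bS : b \notin S by apply: contra bS'; apply/subsetP.
  have [nx ib] := I4 _ _ wb bS; have [px xr ix] := I3 _ _ wb.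
  have bp : b != p by apply: contraNneq bS' => ->; rewrite !inE eqxx.
  have by' : b != y by apply: contraNneq bS' => ->; rewrite !inE eqxx orbT.
  have ib' : idx b < j.
    by rewrite ltn_neqAle -ltnS ib andbT -ip; apply: contraNneq bp => /index_inj ->.
  split=> //.
  have dxp : d p < d x by apply: I6; rewrite // ip.
  have dbp : d b <= d p by apply: q_sorted; rewrite ip ltnW.
  have dxb := depth_par L xr; rewrite px in dxb.
  have dx : d x = (d p).+1 by clear - dxp dbp dxb; lia.
  (* The witness [x] of [b] stays undominated: a neighbour [p] or sibling [y] would be its parent,
     the parent of [p] is two levels away, and the child [v] meets on its level only children of
     [p]. *)
  apply/negP=> /domP[z zS']; move: zS'; rewrite !inE => /or3P[/eqP->|/eqP->|zS xz].
  + case/predU1P=> [xp|/(par_unique bG L)/(_ dx)]; first by rewrite xp ltnn in dxp.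
    by rewrite px => /esym/eqP; apply/negP.
  + case: Py by' {bS' S' sS ndS ay yS cS' py} => [z' az dz zS wz|H pr ppS|H ppS] by' xz.
    * case/predU1P: xz => [xz|/(par_unique bG L)]; first by rewrite xz dz ltnn in dxp.
      by rewrite dz px => /(_ dx)/esym/eqP; apply/negP.
    * have dp := depth_par L pr.
      case/predU1P: xz => [xz|]; first by rewrite xz in dxp; clear - dp dxp; lia.
      by rewrite (graph_sym bG) => /(adj_depth L) dxy; clear - dp dx dxy; lia.
    * case/predU1P: xz => [xz|/(par_level bG L)]; first by rewrite -px xz pv eqxx in bp.
      by rewrite px pv dv => /(_ dx)/eqP; apply/negP.
  by move/negP: nx; apply; apply/domP; exists z.
- by move=> x /ndS nx; apply: I5.
- by move=> x b ix ib; apply: I6; rewrite // ltnW.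
- move=> x b; rewrite leq_eqVlt => /predU1P[e|ib]; last exact: I7.
  by have -> : b = p; [apply: index_inj; rewrite ip | apply: maxp].
Qed.

Lemma greedy_mark_skip i j S wit x : idx x = i -> x = root \/ dom S x ->
  (forall b, idx b < j -> d b < d x) ->
  greedy_inv i.+1 j S wit -> greedy_inv i j S wit.
Proof.
move=> ix xd dj [I1 I2 I3 I4 I5 I6 I7]; split=> //.
- by move=> b y /I3[? ? /ltnW].
- move=> y ny; rewrite leq_eqVlt => /predU1P[e|]; last exact: I5.
  have -> : y = x by apply: index_inj; rewrite ix.
  by case: xd => [->|xd]; rewrite ?eqxx //; move: ny; rewrite (index_inj (etrans (esym e) (esym ix))) xd.
- move=> y b; rewrite leq_eqVlt => /predU1P[e|]; last exact: I6.
  by have -> : y = x by [apply: index_inj; rewrite ix]; apply: dj.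
- by move=> y b jb /ltnW; apply: I7.
Qed.

(** Overwriting an older witness of [par x] is harmless, one per parent being enough. *)
Lemma greedy_mark i j S wit x : idx x = i -> x != root -> ~~ dom S x ->
  (forall b, idx b < j -> d b < d x) ->
  greedy_inv i.+1 j S wit ->
  greedy_inv i j S (fun b => if b == par x then Some x else wit b).
Proof.
move=> ix xr nx dj [I1 I2 I3 I4 I5 I6 I7]; split=> //.
- move=> b y; case: eqVneq => [-> [<-]|_ /I3[? ? /ltnW //]]; split=> //.
  by rewrite ix.
- move=> b y; case: eqVneq => [-> [<-] _|_]; last exact: I4.
  (* Had [par x] been served already, [inv_level] would put the unexamined [x] no deeper than its
     own parent. *)
  split=> //; rewrite ltnNge; apply/negP=> /I7-/(_ x).
  by rewrite ix leqnn (depth_par L xr) ltnn => /(_ isT).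
- move=> y ny; case: (eqVneq (par y) (par x)) => // npy.
  rewrite leq_eqVlt => /predU1P[e|]; last exact: I5.
  by case/eqP: npy; congr par; apply: index_inj; rewrite ix.
- move=> y b; rewrite leq_eqVlt => /predU1P[e|]; last exact: I6.
  by have -> : y = x by [apply: index_inj; rewrite ix]; apply: dj.
- by move=> y b jb /ltnW; apply: I7.
Qed.

(** At the end no vertex is left to be served, so no unselected parent can hold a witness; the root
    is the only vertex never recorded. *)
Lemma greedy_undominated S wit x : greedy_inv 0 0 S wit -> ~~ dom S x -> x = root.
Proof.
move=> [_ _ _ I4 I5 _ _] nx; apply/eqP; apply: contraT => xr.
case wx : (wit (par x)) (I5 x nx (leq0n _) xr) => [u|//] _.
by have [_] := I4 _ _ wx (undominated_par nx xr).
Qed.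

Lemma greedy_done S wit : greedy_inv 0 0 S wit -> dom S root ->
  minimum_paired_dominating G S.
Proof.
move=> I rS; apply: minimum_of_ext (inv_matched I) _ _ => // [x|k /(inv_ext I)[k' _]].
  by apply: contraT => nx; move: (nx); rewrite (greedy_undominated I nx) rS.
by apply: leq_trans; rewrite leq_addr.
Qed.

Lemma greedy_done_root S wit y : greedy_inv 0 0 S wit -> ~~ dom S root ->
  adj G root y -> minimum_paired_dominating G (root |: (y |: S)).
Proof.
move=> I nr ry; set S' := root |: _.
have rS : root \notin S by apply: contra nr => rS; apply/domP; exists root; rewrite // /cl eqxx.
have yS : y \notin S by apply: contra nr => yS; apply/domP; exists y; rewrite // /cl ry orbT.
have sS : S \subset S' by apply/subsetP=> z zS; rewrite !inE zS !orbT.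
have rS' : root \in S' by rewrite !inE eqxx.
apply: minimum_of_ext => //.
- exact: matchedU2 (inv_matched I).
- move=> x; have [/(domS sS)//|/(greedy_undominated I) ->] := boolP (dom S x).
  by apply/domP; exists root; rewrite // /cl eqxx.
have onlyr x : ~~ dom S x -> x = root by apply: greedy_undominated I.
move=> k /(inv_ext I)[k' /(ext_root nr onlyr sS rS')[k'' -> _]].
rewrite !cardsU1 !inE (negPf (adj_neq bG ry)) (negPf rS) yS /=; lia.
Qed.

End Greedy.

(** * Running programs within a budget *)

Section Runs.
Variable w : nat.
Implicit Types (p : cmd) (s : store) (t : nat) (Q : nat -> store -> Prop).

(* [Q] receives the part of the budget [t] that is left over. *)
Definition runs p s t Q := exists t' s', [/\ exec w p s t' s', t' <= t & Q (t - t') s'].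

Lemma runs_conseq p s t Q Q' :
  (forall t' s', Q t' s' -> Q' t' s') -> runs p s t Q -> runs p s t Q'.
Proof. by move=> QQ' [t' [s' [? ? /QQ']]]; exists t', s'. Qed.

Lemma runs_skip s t Q : 0 < t -> Q (t - 1) s -> runs Skip s t Q.
Proof. by exists 1, s; split=> //; apply: ExecSkip. Qed.

Lemma runs_seq p1 p2 s t Q :
  runs p1 s t (fun t' s' => runs p2 s' t' Q) -> runs (Seq p1 p2) s t Q.
Proof.
case=> t1 [s1 [e1 le1 [t2 [s2 [e2 le2 q]]]]]; exists (t1 + t2), s2.
split; [exact: ExecSeq e1 e2 | by rewrite -leq_subRL | by rewrite subnDA].
Qed.

Lemma runs_reg x e s t Q : exp_cost e < t ->
  Q (t - (exp_cost e).+1) (set_reg s x (eval w s e)) -> runs (SetReg x e) s t Q.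
Proof. by move=> lt q; do 2!eexists; split; [apply: ExecSetReg | exact: lt | exact: q]. Qed.

Lemma runs_arr a e1 e2 s t Q : exp_cost e1 + exp_cost e2 < t ->
  Q (t - (exp_cost e1 + exp_cost e2).+1) (set_arr s a (eval w s e1) (eval w s e2)) ->
  runs (SetArr a e1 e2) s t Q.
Proof. by move=> lt q; do 2!eexists; split; [apply: ExecSetArr | exact: lt | exact: q]. Qed.

Lemma runs_if b p1 p2 s t Q : test_cost b < t ->
  (holds w s b -> runs p1 s (t - (test_cost b).+1) Q) ->
  (~~ holds w s b -> runs p2 s (t - (test_cost b).+1) Q) -> runs (If b p1 p2) s t Q.
Proof.
move=> lt h1 h2; have [hb|hb] := boolP (holds w s b).
  case: (h1 hb) => t' [s' [ex le q]]; exists (test_cost b + t').+1, s'.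
  split; [exact: ExecIfTrue | by rewrite -addSn -leq_subRL | by rewrite -addSn subnDA].
case: (h2 hb) => t' [s' [ex le q]]; exists (test_cost b + t').+1, s'.
split; [exact: ExecIfFalse | by rewrite -addSn -leq_subRL | by rewrite -addSn subnDA].
Qed.

(** The budget doubles as the variant: each round spends at least one unit, so an invariant that
    keeps the test affordable yields termination and cost together. *)
Lemma runs_while (I : nat -> store -> Prop) b p s t Q :
  (forall t s, I t s -> test_cost b < t) ->
  (forall t s, I t s -> holds w s b -> runs p s (t - (test_cost b).+1) I) ->
  (forall t s, I t s -> ~~ holds w s b -> Q (t - (test_cost b).+1) s) ->
  I t s -> runs (While b p) s t Q.
Proof.
move=> cI bI qI; have [m] := ubnP t; elim: m t s => // m IH t s ltm It.
have lt := cI t s It; have [hb|hb] := boolP (holds w s b); last first.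
  by exists (test_cost b).+1, s; split; [exact: ExecWhileFalse | | exact: qI].
have [t1 [s1 [e1 le1 I1]]] := bI t s It hb.
have [|t2 [s2 [e2 le2 q]]] := IH _ _ _ I1; first by clear - ltm lt; lia.
exists (test_cost b + t1 + t2).+1, s2; split; first exact: ExecWhileTrue e1 e2.
  by clear - lt le1 le2; lia.
by rewrite -!addSn !subnDA.
Qed.

(* Registers 4, 5 and 6 hold the current position in the adjacency list, its end
   and the current neighbour; register 7 receives the result of a search, shifted
   by one so that 0 means failure. *)
Definition foreach x p :=
  Seq (SetReg 4 (Arr 0 (Reg x)))
  (Seq (SetReg 5 (Arr 0 (Add (Reg x) (Cst 1))))
  (While (Lt (Reg 4) (Reg 5))
    (Seq (SetReg 6 (Arr 1 (Reg 4))) (Seq p (SetReg 4 (Add (Reg 4) (Cst 1))))))).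

Definition search x b :=
  Seq (SetReg 7 (Cst 0)) (foreach x (If b (SetReg 7 (Add (Reg 6) (Cst 1))) Skip)).

Section Neighbours.
Variables (n : nat) (nb : 'I_n -> seq 'I_n) (off : 'I_n -> nat).
Hypotheses (w_n : n.+1 < 2 ^ w) (w_off : forall u, off u + size (nb u) < 2 ^ w).

Lemma one_mod : 1 %% 2 ^ w = 1.
Proof. by rewrite modn_small //; lia. Qed.

Lemma ord_mod (u : 'I_n) : (u + 1) %% 2 ^ w = u.+1.
Proof. by rewrite modn_small addn1 //; have := ltn_ord u; lia. Qed.

Definition graph_store s : Prop :=
  [/\ reg s 0 = n,
      forall u : 'I_n, arr s 0 u = off u,
      forall u : 'I_n, arr s 0 u.+1 = off u + size (nb u)
    & forall (u : 'I_n) D y E, nb u = D ++ y :: E -> arr s 1 (off u + size D) = y].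

Lemma graph_store_reg s r k : r != 0 -> graph_store s -> graph_store (set_reg s r k).
Proof. by case: r => // r _ []. Qed.

(** 12 = 3 + 5 + 4 pays for the two initial assignments and the failing test; 11 = 4 + 3 + 4 for
    test, load and increment in each round. *)
Lemma runs_foreach x (u : 'I_n) p c (I : seq 'I_n -> store -> Prop) s t Q :
  graph_store s -> reg s x = u -> x \notin [:: 4; 5; 6] ->
  (forall D s r k, r \in [:: 4; 5; 6] -> I D s -> I D (set_reg s r k)) ->
  I [::] s ->
  (forall D y E s t, nb u = D ++ y :: E -> I D s -> graph_store s -> reg s 6 = y -> c <= t ->
     runs p s t (fun t' s' => [/\ t <= t' + c, I (rcons D y) s', graph_store s',
       reg s' 4 = reg s 4 & reg s' 5 = reg s 5])) ->
  12 + (c + 11) * size (nb u) <= t ->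
  (forall s' t', t <= t' + (12 + (c + 11) * size (nb u)) ->
     I (nb u) s' -> graph_store s' -> Q t' s') ->
  runs (foreach x p) s t Q.
Proof.
move=> gs xu x456 Ireg I0 Ip ct q.
have x4 : x != 4 by apply: contraNneq x456 => ->.
apply: runs_seq; apply: runs_reg => /=; first lia.
apply: runs_seq; apply: runs_reg => /=; first lia.
rewrite (negPf x4) xu one_mod ord_mod; case: (gs) => [_ -> -> _].
set s1 := set_reg _ _ _.
pose J r s := exists D E, [/\ nb u = D ++ E, I D s, graph_store s
  & [/\ reg s 4 = off u + size D, reg s 5 = off u + size (nb u),
      4 + (c + 11) * size E <= r & t <= r + 8 + (c + 11) * size D]].
apply: (runs_while (I := J)).
- by move=> r s2 [D [E [_ _ _ [_ _ cr _]]]] /=; clear - cr; lia.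
- move=> r {}s1 [D [E [eD ID gs1 [r4 r5 cr tr]]]] /=; rewrite r4 r5 ltn_add2l eD size_cat.
  case: E eD cr => [|y E] eD cr; first by rewrite addn0 ltnn.
  move=> _; rewrite /= in cr.
  apply: runs_seq; apply: runs_reg => /=; first by clear - cr; lia.
  rewrite r4; case: (gs1) => [_ _ _ /(_ u D y E eD) ->].
  apply: runs_seq; set s2 := set_reg _ _ _.
  have := Ip D y E s2 (r - 4 - 3) eD (Ireg D s1 6 y isT ID) (@graph_store_reg s1 6 y isT gs1) erefl.
  have lc : c <= r - 4 - 3 by clear - cr; lia.
  move=> /(_ lc); apply: runs_conseq => r' s3 [cr' I3 gs3]; rewrite /= => r34 r35.
  apply: runs_reg => /=; first by clear - cr cr'; lia.
  have wD := w_off u; rewrite eD size_cat /= in wD.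
  rewrite r34 r4 one_mod modn_small; last by clear - wD; lia.
  exists (rcons D y), E; split.
  + by rewrite cat_rcons.
  + exact: Ireg.
  + exact: graph_store_reg.
  + rewrite /= r35 r5 eD size_rcons !size_cat /= addnA -addnA addn1.
    by split=> //; clear - cr cr' tr; lia.
- move=> r {}s1 [D [E [eD ID gs1 [r4 r5 cr tr]]]] /=; rewrite r4 r5 ltn_add2l eD size_cat.
  case: E eD cr => [|y E] eD cr; last by rewrite -[X in X < _]addn0 ltn_add2l.
  move=> _; apply: q => //; rewrite eD cats0 //.
  by clear - cr tr; lia.
exists [::], (nb u); split=> //.
- by apply: (Ireg _ _ 5) => //; apply: (Ireg _ _ 4).
- by split=> //=; rewrite ?addn0 // ?muln0; clear - ct; lia.
Qed.

(** The scan never stops early, so the last hit is returned; [b] may read only the arrays, register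
    6 and registers the scan leaves alone. *)
Lemma runs_search x (u : 'I_n) b (P : pred 'I_n) s t Q :
  graph_store s -> reg s x = u -> x \notin [:: 4; 5; 6; 7] ->
  (forall s' (y : 'I_n), arr s' = arr s ->
     (forall r, r \notin [:: 4; 5; 6; 7] -> reg s' r = reg s r) ->
     reg s' 6 = y -> holds w s' b = P y) ->
  14 + (test_cost b + 16) * size (nb u) <= t ->
  (forall s' t', t <= t' + (14 + (test_cost b + 16) * size (nb u)) ->
     arr s' = arr s -> (forall r, r \notin [:: 4; 5; 6; 7] -> reg s' r = reg s r) ->
     graph_store s' ->
     reg s' 7 = 0 /\ {in nb u, forall y, ~~ P y} \/
     (exists2 y : 'I_n, (y \in nb u) && P y & reg s' 7 = y.+1) -> Q t' s') ->
  runs (search x b) s t Q.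
Proof.
move=> gs xu x4567 bP ct q.
have x7 : x != 7 by apply: contraNneq x4567 => ->.
have x456 : x \notin [:: 4; 5; 6].
  by apply: contra x4567; rewrite !inE => /or3P[]->; rewrite ?orbT.
apply: runs_seq; apply: runs_reg => /=; first lia.
rewrite mod0n; set s1 := set_reg s 7 0.
pose I (D : seq 'I_n) s' := [/\ arr s' = arr s, forall r, r \notin [:: 4; 5; 6; 7] -> reg s' r = reg s r
  & reg s' 7 = 0 /\ {in D, forall y, ~~ P y} \/
     (exists2 y : 'I_n, (y \in D) && P y & reg s' 7 = y.+1)].
apply: (runs_foreach (u := u) (I := I) (c := test_cost b + 5)).
- exact: graph_store_reg.
- by rewrite /= (negPf x7).
- exact: x456.
- move=> D s' r k r456 [As' Rs' Fs']; have r7 : (7 == r) = false.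
    by apply: contraTF r456 => /eqP <-.
  split=> //= [r' nr'|]; last by rewrite r7.
  by case: eqP nr' => [->|_ /Rs' //]; move: r456; rewrite !inE => /or3P[]->; rewrite ?orbT.
- split=> //= [r|]; last by left.
  by case: eqP => // ->.
- move=> D y E s2 t2 eD [As2 Rs2 Fs2] gs2 r6 ct2.
  apply: runs_if; first by clear - ct2; lia.
    rewrite (bP s2 y) // => Py; apply: runs_reg => /=; first by clear - ct2; lia.
    rewrite r6 one_mod ord_mod; split=> //=; first by clear - ct2; lia.
      split=> //= [r nr|]; last by right; exists y; rewrite // mem_rcons mem_head Py.
      by case: eqP nr => [->|_ /Rs2].
  rewrite (bP s2 y) // => Py; apply: runs_skip; first by clear - ct2; lia.
  split=> //; first by clear - ct2; lia.
  split=> //; case: Fs2 => [[f0 nP]|[z /andP[zD Pz] fz]].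
    by left; split=> // z; rewrite mem_rcons inE => /predU1P[->|/nP].
  by right; exists z; rewrite // mem_rcons inE zD orbT.
- by clear - ct; lia.
move=> s' t' ct' [As' Rs' Fs'] gs'; apply: q => //.
by clear - ct ct'; lia.
Qed.

End Neighbours.
End Runs.

(** * Breadth-first search *)

Section Input.
Variables (n : nat) (G : graph 'I_n) (nb : 'I_n -> seq 'I_n) (v : 'S_n).

Definition offset (u : 'I_n) := \sum_(x < n | x < u) size (nb x).

Lemma offset_take u :
  offset u = size (flatten [seq nb x | x <- take u (enum 'I_n)]).
Proof.
rewrite size_flatten /shape -map_comp sumnE big_map /offset.
transitivity (\sum_(x <- enum 'I_n | x < u) size (nb x)); first by rewrite big_enum_cond.
rewrite -{1}(cat_take_drop u (enum 'I_n)) big_cat /= [X in _ + X]big1_seq ?addn0.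
  rewrite big_seq_cond [RHS]big_seq_cond; apply: eq_bigl => x; rewrite andbT.
  have [xt|//] := boolP (x \in take u (enum 'I_n)).
  by have := in_take u (mem_enum 'I_n x); rewrite xt index_enum_ord => <-.
move=> x /andP[xu xd]; have := enum_uniq 'I_n.
rewrite -(cat_take_drop u (enum 'I_n)) cat_uniq => /and3P[_ /hasPn/(_ x xd) + _].
by rewrite /= in_take ?mem_enum // index_enum_ord xu.
Qed.

Lemma offset_succ (u : 'I_n) :
  \sum_(x < n | x < u.+1) size (nb x) = offset u + size (nb u).
Proof.
rewrite (bigD1 u) //= addnC; congr (_ + _); apply: eq_bigl => x.
by rewrite ltnS ltn_neqAle andbC.
Qed.

Lemma offset_bound (u : 'I_n) : offset u + size (nb u) <= \sum_x size (nb x).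
Proof. by rewrite -offset_succ big_mkcond leq_sum // => x _; case: ifP. Qed.

Lemma graph_store_input : graph_store nb offset (input nb v).
Proof.
split=> //= [u|u|u D y E eD].
- by rewrite ltnW.
- by rewrite ltn_ord offset_succ.
have us : u < size (enum 'I_n) by rewrite size_enum_ord.
rewrite -{1}(cat_take_drop u (enum 'I_n)) (drop_nth u us) nth_ord_enum.
rewrite map_cat flatten_cat /= eD -catA map_cat nth_cat size_map offset_take.
rewrite ltnNge leq_addr /= addKn map_cat nth_cat size_map ltnn subnn //.
Qed.

Hypotheses (sG : simple_graph G) (nbP : adjacency_lists G nb).

(** The degree sum counts ordered adjacent pairs; the increasing ones inject into the edges, and
    swapping them gives the others. *)
Lemma sum_degrees : \sum_u size (nb u) <= 2 * #|edges G|.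
Proof.
case: sG => symG irrG _.
pose P := [set p : 'I_n * 'I_n | adj G p.1 p.2 && (p.1 < p.2)].
have leP : #|P| <= #|edges G|.
  rewrite -(card_in_imset (f := fun p => [set p.1; p.2]) (D := P)).
    apply/subset_leq_card/subsetP=> _ /imsetP[p /[!inE] /andP[ap _] ->].
    by apply/imsetP; exists p; rewrite ?inE.
  case=> [a b] [c e]; rewrite !inE /= => /andP[_ ab] /andP[_ ce] /setP eq.
  have := eq a; have := eq b; rewrite !inE !eqxx orbT /=.
  move=> /esym/orP[]/eqP eb /esym/orP[]/eqP ea; subst => //; rewrite ?ltnn // in ab ce *.
  by have := ltn_trans ab ce; rewrite ltnn.
have -> : \sum_u size (nb u) = #|[set p : 'I_n * 'I_n | adj G p.1 p.2]|.
  rewrite -sum1_card (eq_bigl (fun p => xpredT p.1 && adj G p.1 p.2)); last by move=> p; rewrite !inE.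
  rewrite -(pair_big_dep xpredT (fun u x => adj G u x) (fun _ _ => 1)) /=.
  apply: eq_bigr => u _; have [uu mu] := nbP u.
  rewrite sum1_card -(card_uniqP uu); apply: eq_card => x.
  by rewrite mu unfold_in.
have sub : [set p : 'I_n * 'I_n | adj G p.1 p.2]
    \subset P :|: [set (p.2, p.1) | p in P].
  apply/subsetP=> -[a b] /[!inE] /= ab; rewrite ab /=.
  have [//|ba|/val_inj eab] := ltngtP a b; last by rewrite eab irrG in ab.
  by apply/imsetP; exists (b, a); rewrite ?inE //= symG ab ba.
apply: leq_trans (subset_leq_card sub) _; apply: leq_trans (leq_card_setU _ _) _.
have := leq_imset_card (fun p => (p.2, p.1)) P.
by move: leP; clear; lia.
Qed.

End Input.

Lemma leq_sum_uniq (T : finType) (s : seq T) (F : T -> nat) :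
  uniq s -> \sum_(x <- s) F x <= \sum_x F x.
Proof.
by move=> us; rewrite big_uniq //= [X in _ <= X](bigID (mem s)) /= leq_addr.
Qed.

(* Register 1 is the head and register 2 the tail of the queue in array 6;
   array 4 holds depths shifted by one (0 means unseen) and array 5 parents. *)
Definition bfs :=
  Seq (SetArr 4 (Cst 0) (Cst 1)) (Seq (SetReg 2 (Cst 1))
  (While (Lt (Reg 1) (Reg 2))
    (Seq (SetReg 3 (Arr 6 (Reg 1)))
    (Seq (foreach 3
      (If (Eq (Arr 4 (Reg 6)) (Cst 0))
        (Seq (SetArr 4 (Reg 6) (Add (Arr 4 (Reg 3)) (Cst 1)))
        (Seq (SetArr 5 (Reg 6) (Reg 3))
        (Seq (SetArr 6 (Reg 2) (Reg 6))
             (SetReg 2 (Add (Reg 2) (Cst 1))))))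
        Skip))
    (SetReg 1 (Add (Reg 1) (Cst 1))))))).

Section Search.
Variables (w n : nat) (G : graph 'I_n) (nb : 'I_n -> seq 'I_n) (off : 'I_n -> nat).
Variable root : 'I_n.
Hypotheses (root0 : root = 0 :> nat) (vG : verts G = setT) (bG : block_graph G).
Hypothesis nbP : adjacency_lists G nb.
Hypotheses (w_n : n.+1 < 2 ^ w) (w_off : forall u, off u + size (nb u) < 2 ^ w).
Implicit Types (q : seq 'I_n) (s : store).

(* The queue [q] lists the visited vertices; the first [h] of them have been
   expanded, and so has the next one as far as its neighbours in [D]. *)
Record bfs_inv q h (D : seq 'I_n) s : Prop := BfsInv {
  bfs_head : reg s 1 = h;
  bfs_tail : reg s 2 = size q;
  bfs_uniq : uniq q;
  bfs_root : 0 < size q /\ nth root q 0 = root;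
  bfs_queue : forall i, i < size q -> arr s 6 i = nth root q i;
  bfs_seen : forall x : 'I_n, (arr s 4 x == 0) = (x \notin q);
  bfs_dep_root : arr s 4 root = 1;
  bfs_dep_le : forall x : 'I_n, x \in q -> arr s 4 x <= size q;
  bfs_sorted : forall i j, i <= j -> j < size q ->
    arr s 4 (nth root q i) <= arr s 4 (nth root q j);
  bfs_window : forall x, h < size q -> x \in q ->
    arr s 4 x <= (arr s 4 (nth root q h)).+1;
  bfs_par : forall x, x \in q -> x != root -> exists2 p : 'I_n, arr s 5 x = p &
    [/\ p \in q, adj G x p & arr s 4 x = (arr s 4 p).+1];
  bfs_expanded : forall i y, i < h -> adj G (nth root q i) y ->
    y \in q /\ arr s 4 y <= (arr s 4 (nth root q i)).+1;
  bfs_expanding : {in D, forall y : 'I_n,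
    y \in q /\ arr s 4 y <= (arr s 4 (nth root q h)).+1};
  bfs_clean : forall x, arr s 3 x = 0 /\ arr s 7 x = 0 }.

Definition bfs_result q (d : 'I_n -> nat) (par : 'I_n -> 'I_n) s : Prop :=
  [/\ layering G root d par, uniq q, forall x, x \in q,
      forall x y, index x q <= index y q -> d x <= d y
   & [/\ forall x : 'I_n, arr s 4 x = (d x).+1,
         forall x : 'I_n, x != root -> arr s 5 x = par x,
         forall i, i < size q -> arr s 6 i = nth root q i
       & forall x, arr s 3 x = 0 /\ arr s 7 x = 0]].

Lemma bfs_inv_reg q h D s r k : r \notin [:: 1; 2] ->
  bfs_inv q h D s -> bfs_inv q h D (set_reg s r k).
Proof.
by case: r => [|[|[|r]]] // _ [i1 i2 i3 i4 i5 i6 i7 i8 i9 i10 i11 i12 i13 i14]; split.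
Qed.

Lemma bfs_done q s : bfs_inv q (size q) [::] s -> exists d par, bfs_result q d par s.
Proof.
case=> _ _ i3 [i4 i4'] i5 i6 i7 _ i9 _ i11 i12 _ i14.
have q_all x : x \in q.
  have rq : root \in q by rewrite -i4' mem_nth.
  (* With every entry expanded, [q] is closed under adjacency, so connectedness makes it exhaust the
     vertices. *)
  have clq : closed (adj G) q.
    apply: intro_closed; first by apply: sym_connect_sym; case: bG => -[].
    move=> a b ab /(nthP root)[i ii ea]; rewrite -ea in ab.
    by case: (i12 i b ii ab).
  rewrite -(closed_connect clq _ : (root \in q) = _) //.
  by case: bG => _ [_ +] _; apply; rewrite vG inE.
(* The fallback of [insubd] can matter only at [root]: all other parent cells hold vertices. *)
exists (fun x : 'I_n => (arr s 4 x).-1), (fun x : 'I_n => insubd root (arr s 5 x)).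
have pos (x : 'I_n) : 0 < arr s 4 x by rewrite lt0n i6 q_all.
have ix x : index x q < size q by rewrite index_mem.
split=> //; first split=> [|x y xy|x xr].
- by rewrite i7.
- have := i12 (index x q) y (ix x); rewrite nth_index // => /(_ xy)[_].
  by have := pos x; have := pos y; clear; lia.
- have [p -> [_ xp ->]] := i11 x (q_all x) xr; rewrite valKd.
  by split=> //; have := pos p; clear; lia.
- move=> x y xy; have := i9 _ _ xy (ix y); rewrite !nth_index //.
  by have := pos x; have := pos y; clear; lia.
split=> // x; first by have := pos x; clear; lia.
by move=> xr; have [p -> _] := i11 x (q_all x) xr; rewrite valKd.
Qed.

Lemma bfs_skip q h D s y : bfs_inv q h D s -> h < size q -> y \in q ->
  bfs_inv q h (rcons D y) s.
Proof.
case=> i1 i2 i3 i4 i5 i6 i7 i8 i9 i10 i11 i12 i13 i14 hq yq; split=> //.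
by move=> z; rewrite mem_rcons inE => /predU1P[->|/i13//]; split=> //; apply: i10.
Qed.

(** The new vertex gets one more than the depth of the head, the largest value [bfs_window] allows,
    so the queue stays sorted. *)
Lemma bfs_visit q h D s y (u := nth root q h) :
  bfs_inv q h D s -> h < size q -> adj G u y -> y \notin q ->
  bfs_inv (rcons q y) h (rcons D y)
    (set_reg (set_arr (set_arr (set_arr s 4 y (arr s 4 u).+1) 5 y u) 6 (size q) y) 2 (size q).+1).
Proof.
move=> + hq uy yq; case=> i1 i2 i3 [i4 i4'] i5 i6 i7 i8 i9 i10 i11 i12 i13 i14.
set s' := set_reg _ _ _.
have neqy z : z \in q -> ((z : nat) == y) = false.
  by move=> zq; apply: contraNF yq => /eqP/val_inj <-.
have depy : arr s' 4 y = (arr s 4 u).+1 by rewrite /= eqxx.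
have depq z : z \in q -> arr s' 4 z = arr s 4 z by move=> zq; rewrite /= neqy.
have pary : arr s' 5 y = u by rewrite /= eqxx.
have parq z : z \in q -> arr s' 5 z = arr s 5 z by move=> zq; rewrite /= neqy.
have uq : u \in q by rewrite mem_nth.
have nthq i : i < size q -> nth root (rcons q y) i = nth root q i.
  by move=> iq; rewrite nth_rcons iq.
have nthy : nth root (rcons q y) (size q) = y by rewrite nth_rcons ltnn eqxx.
have inq z : z \in q -> z \in rcons q y by rewrite mem_rcons inE orbC => ->.
have yq' : y \in rcons q y by rewrite mem_rcons mem_head.
have caseq z : z \in rcons q y -> z = y \/ z \in q by rewrite mem_rcons inE => /predU1P.
have rq : root \in q by rewrite -i4' mem_nth.
split=> //.
- by rewrite /= size_rcons.
- by rewrite rcons_uniq yq.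
- by rewrite size_rcons nthq.
- move=> i; rewrite size_rcons ltnS leq_eqVlt => /predU1P[->|iq].
    by rewrite nthy /= eqxx.
  by rewrite nthq // /= (ltn_eqF iq) i5.
- move=> x; rewrite mem_rcons inE; have [->|xy] := eqVneq x y; first by rewrite depy.
  by rewrite /= (inj_eq val_inj) (negPf xy) i6.
- by rewrite depq.
- move=> x; rewrite size_rcons => /caseq[->|xq]; first by rewrite depy ltnS i8.
  by rewrite depq // ltnW // ltnS i8.
- move=> i j ij; rewrite size_rcons ltnS leq_eqVlt => /predU1P[ej|jq]; last first.
    by rewrite !nthq ?(leq_ltn_trans ij) // !depq ?mem_nth ?(leq_ltn_trans ij) ?i9.
  subst j; rewrite nthy; move: ij; rewrite leq_eqVlt => /predU1P[->|iq]; first by rewrite nthy.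
  by rewrite nthq // depq ?mem_nth // depy i10 ?mem_nth.
- move=> x _ /caseq[->|xq]; rewrite nthq // -/u (depq u) // ?depy // depq //.
  exact: i10.
- move=> x /caseq[->|xq] xr.
    exists u; first exact: pary.
    by split; [exact: inq | rewrite (graph_sym bG) | rewrite depy (depq u)].
  have [p px [pq xp dx]] := i11 x xq xr; exists p; first by rewrite parq.
  by split; [exact: inq | | rewrite (depq x) // (depq p)].
- move=> i z ih; have iq := ltn_trans ih hq; rewrite nthq // => /(i12 _ _ ih)[zq dz].
  by rewrite inq // !depq ?mem_nth.
move=> z; rewrite nthq // mem_rcons inE => /predU1P[->|/i13[zq dz]].
  by rewrite yq' depy depq.
by rewrite inq // !depq.
Qed.

Lemma bfs_next q h s : bfs_inv q h (nb (nth root q h)) s -> h < size q ->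
  bfs_inv q h.+1 [::] (set_reg s 1 h.+1).
Proof.
case=> i1 i2 i3 [i4 i4'] i5 i6 i7 i8 i9 i10 i11 i12 i13 i14 hq; split=> //.
- move=> x hq' /(i10 x hq); move/leq_trans; apply.
  by rewrite ltnS; apply: i9.
- move=> i z; rewrite ltnS leq_eqVlt => /predU1P[->|]; last exact: i12.
  by have [_ <-] := nbP (nth root q h); apply: i13.
Qed.

(** The root is vertex 0 because the blank cell 0 of array 6 then already enqueues it. *)
Lemma bfs_init s : (forall a i, 3 <= a -> arr s a i = 0) -> reg s 1 = 0 ->
  bfs_inv [:: root] 0 [::] (set_reg (set_arr s 4 0 1) 2 1).
Proof.
move=> s0 s1; have root_eq (x : 'I_n) : (x == 0 :> nat) = (x == root) by rewrite -root0.
split=> //.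
- by case=> // _; rewrite /= s0.
- by move=> x; rewrite /= root_eq inE; have [//|_] := eqVneq x root; rewrite s0.
- by rewrite /= root0.
- by move=> x; rewrite inE => /eqP ->; rewrite /= root0.
- by move=> [|i] [|j].
- by move=> x _; rewrite inE => /eqP ->.
- by move=> x; rewrite inE => /eqP ->; rewrite eqxx.
by move=> x; rewrite /= !s0.
Qed.

(** 23 = 4 + 3 + 12 + 4: loop test, fetch, fixed part of [foreach], advance of the head. 32 = 21 +
    11, where 21 is the cost of a first visit. *)
Definition bfs_cost u := 23 + 32 * size (nb u).

Lemma runs_bfs s t Q : graph_store nb off s ->
  (forall a i, 3 <= a -> arr s a i = 0) -> reg s 1 = 0 ->
  10 + \sum_u bfs_cost u <= t ->
  (forall s' t' q d par, t <= t' + (10 + \sum_u bfs_cost u) -> graph_store nb off s' ->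
     bfs_result q d par s' -> Q t' s') ->
  runs w bfs s t Q.
Proof.
set Z := \sum_u _ => gs s0 s1 ct post; have w1 : 1 %% 2 ^ w = 1 by apply: one_mod w_n.
apply: runs_seq; apply: runs_arr => /=; first lia.
apply: runs_seq; apply: runs_reg => /=; first lia.
rewrite mod0n w1.
pose J r s' := exists q h, [/\ bfs_inv q h [::] s', graph_store nb off s', h <= size q
  & t <= r + 6 + \sum_(x <- take h q) bfs_cost x].
have take_le q h : uniq q -> \sum_(x <- take h q) bfs_cost x <= Z.
  by move=> uq; apply: leq_sum_uniq; apply: take_uniq.
apply: (runs_while (I := J)).
- move=> r s2 [q [h [I2 _ _ cr]]] /=; have := take_le q h (bfs_uniq I2).
  by clear - cr ct; lia.
- move=> r s2 [q [h [I2 gs2 hq cr]]] /=; rewrite (bfs_head I2) (bfs_tail I2) => hq'.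
  have := take_le q h.+1 (bfs_uniq I2); set u := nth root q h.
  rewrite (take_nth root hq') -cats1 big_cat big_seq1 -/u /= => cq.
  have cu : bfs_cost u = 23 + 32 * size (nb u) by [].
  apply: runs_seq; apply: runs_reg => /=; first by clear - cr cq ct cu; lia.
  rewrite (bfs_head I2) (bfs_queue I2) // -/u.
  apply: runs_seq.
  pose I D s3 := exists q', [/\ bfs_inv q' h D s3, h < size q', nth root q' h = u,
    take h q' = take h q & reg s3 3 = u].
  apply: (@runs_foreach w n nb off w_n w_off 3 u _ 21 I) => //.
  + move=> D s3 r3 k r456 [q' [I3 hq3 eu tq r3u]]; exists q'; split=> //.
      apply: bfs_inv_reg => //; by apply: contraL r456; rewrite !inE => /orP[]/eqP->.
    by rewrite /=; case: eqP r456 => // <-.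
  + by exists q; split=> //; apply: bfs_inv_reg.
  + move=> D y E s3 t3 eD [q' [I3 hq3 eu tq r3u]] gs3 r6 ct3.
    have uy : adj G u y by have [_ <-] := nbP u; rewrite eD mem_cat mem_head orbT.
    have szq : size q' <= n by have := max_card (mem q'); rewrite card_ord (card_uniqP (bfs_uniq I3)).
    have uq : u \in q' by rewrite -eu mem_nth.
    apply: runs_if; first by clear - ct3; rewrite /=; lia.
      rewrite /= r6 mod0n (bfs_seen I3) => yq.
      apply: runs_seq; apply: runs_arr => /=; first by clear - ct3; lia.
      apply: runs_seq; apply: runs_arr => /=; first by clear - ct3; lia.
      apply: runs_seq; apply: runs_arr => /=; first by clear - ct3; lia.
      apply: runs_reg => /=; first by clear - ct3; lia.
      rewrite r6 r3u (bfs_tail I3) w1 !modn_small ?addn1; last first.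
      (* A stored depth is at most the queue length, hence at most [n], and its successor does not
         wrap around. *)
      * by have := bfs_dep_le I3 uq; move: w_n; clear - szq; lia.
      * by move: w_n; clear - szq; lia.
      split=> //; first by clear - ct3; lia.
      exists (rcons q' y); split=> //.
      * by rewrite -[X in set_arr _ 5 _ X]/(nat_of_ord u) -eu; apply: bfs_visit; rewrite ?eu.
      * by rewrite size_rcons ltnW.
      * by rewrite nth_rcons hq3.
      * by rewrite -tq -cats1 takel_cat // ltnW.
    rewrite /= r6 mod0n (bfs_seen I3) negbK => yq.
    apply: runs_skip; first by clear - ct3; lia.
    split=> //; first by clear - ct3; lia.
    by exists q'; split=> //; apply: bfs_skip.
  + by clear - cr cq ct cu; lia.
  move=> s3 t3 ct3 [q' [I3 hq3 eu tq r3u]] gs3.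
  apply: runs_reg => /=; first by clear - cr cq ct cu ct3; lia.
  rewrite (bfs_head I3) w1 (addn1 h) modn_small; last first.
    have szq : size q' <= n by have := max_card (mem q'); rewrite card_ord (card_uniqP (bfs_uniq I3)).
    by move: w_n; clear - szq hq3; lia.
  exists q', h.+1; split=> //.
  + by apply: bfs_next => //; rewrite eu.
  + rewrite (take_nth root hq3) tq eu -cats1 big_cat big_seq1 /=.
    by clear - cr cq ct cu ct3; lia.
- move=> r s2 [q [h [I2 gs2 hq cr]]] /=; rewrite (bfs_head I2) (bfs_tail I2) -leqNgt => qh.
  have eh : h = size q by apply/eqP; rewrite eqn_leq hq.
  have := take_le q h (bfs_uniq I2); rewrite {h hq qh}eh in I2 cr *.
  move=> cq; have [d [par]] := bfs_done I2; apply: post => //.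
  by clear - cr cq ct; lia.
exists [:: root], 0; split=> //.
- exact: bfs_init.
- by rewrite take0 big_nil; clear - ct; lia.
Qed.

End Search.

(** * The bottom-up sweep *)

(* Array 7 holds the witnesses of [greedy_inv], shifted by one (0 means none);
   registers 8 and 9 hold its indices [i] and [j]. *)
Definition flush :=
  If (And (Lt (Cst 0) (Arr 7 (Reg 10))) (Eq (Arr 3 (Reg 10)) (Cst 0)))
    (Seq (search 10 (And (Eq (Arr 4 (Reg 6)) (Arr 4 (Reg 10)))
                  (And (Lt (Cst 0) (Arr 7 (Reg 6))) (Eq (Arr 3 (Reg 6)) (Cst 0)))))
    (Seq (If (Lt (Cst 0) (Reg 7)) (SetReg 11 (Defs.Sub (Reg 7) (Cst 1)))
         (If (And (Lt (Cst 0) (Reg 10)) (Eq (Arr 3 (Arr 5 (Reg 10))) (Cst 0)))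
           (SetReg 11 (Arr 5 (Reg 10)))
           (SetReg 11 (Defs.Sub (Arr 7 (Reg 10)) (Cst 1)))))
    (Seq (SetArr 3 (Reg 10) (Cst 1)) (SetArr 3 (Reg 11) (Cst 1)))))
    Skip.

Definition find_dominator := search 3 (Lt (Cst 0) (Arr 3 (Reg 6))).

Definition undominated_test := And (Eq (Reg 7) (Cst 0)) (Eq (Arr 3 (Reg 3)) (Cst 0)).

(** The root is exempt, having no parent to hold a witness; [finish] settles it. *)
Definition mark :=
  Seq find_dominator
    (If (And (Lt (Cst 0) (Reg 3)) undominated_test)
      (SetArr 7 (Arr 5 (Reg 3)) (Add (Reg 3) (Cst 1))) Skip).

(** Everything at least as deep as the vertex about to be examined is served first. This maintains
    [inv_depth], while [inv_level] holds because the queue is read from its deep end. *)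
Definition flush_levels :=
  While (And (Lt (Cst 0) (Reg 9))
             (Not (Lt (Arr 4 (Arr 6 (Defs.Sub (Reg 9) (Cst 1)))) (Arr 4 (Reg 3)))))
    (Seq (SetReg 9 (Defs.Sub (Reg 9) (Cst 1))) (Seq (SetReg 10 (Arr 6 (Reg 9))) flush)).

Definition sweep :=
  Seq (SetReg 8 (Reg 0)) (Seq (SetReg 9 (Reg 0))
  (While (Lt (Cst 0) (Reg 8))
    (Seq (SetReg 8 (Defs.Sub (Reg 8) (Cst 1)))
    (Seq (SetReg 3 (Arr 6 (Reg 8)))
    (Seq flush_levels mark))))).

Definition finish :=
  Seq (SetReg 3 (Cst 0)) (Seq find_dominator
    (If undominated_test
      (Seq (SetArr 3 (Reg 3) (Cst 1)) (SetArr 3 (Arr 1 (Arr 0 (Reg 3))) (Cst 1)))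
      Skip)).

Section Sweep.
Variables (w n : nat) (G : graph 'I_n) (nb : 'I_n -> seq 'I_n) (off : 'I_n -> nat).
Variables (root : 'I_n) (q : seq 'I_n) (d : 'I_n -> nat) (par : 'I_n -> 'I_n).
Hypotheses (root0 : root = 0 :> nat) (vG : verts G = setT) (bG : block_graph G).
Hypothesis nbP : adjacency_lists G nb.
Hypotheses (w_n : n.+1 < 2 ^ w) (w_off : forall u, off u + size (nb u) < 2 ^ w).
Hypotheses (L : layering G root d par) (uq : uniq q) (q_all : forall x, x \in q).
Hypothesis q_sorted : forall x y, index x q <= index y q -> d x <= d y.
Implicit Types (S : {set 'I_n}) (wit : 'I_n -> option 'I_n) (s : store).
Local Notation idx x := (index x q).
Local Notation greedy_inv := (greedy_inv G root d par q).

Let w1 : 1 %% 2 ^ w = 1. Proof. exact: one_mod w_n. Qed.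

Let pos_root (x : 'I_n) : (0 < x) = (x != root).
Proof. by rewrite lt0n -root0. Qed.

Record sweep_state S wit s : Prop := SweepState {
  st_graph : graph_store nb off s;
  st_depth : forall x : 'I_n, arr s 4 x = (d x).+1;
  st_par : forall x : 'I_n, x != root -> arr s 5 x = par x;
  st_queue : forall i, i < size q -> arr s 6 i = nth root q i;
  st_set : forall x : 'I_n, arr s 3 x = (x \in S);
  st_wit : forall x : 'I_n, arr s 7 x = if wit x is Some y then y.+1 else 0 }.

Lemma sweep_state_arr S wit s s' : graph_store nb off s' -> arr s' = arr s ->
  sweep_state S wit s -> sweep_state S wit s'.
Proof. by move=> gs' e [_ ? ? ? ? ?]; split; rewrite ?e. Qed.

Lemma sweep_state_reg S wit s r k : r != 0 ->
  sweep_state S wit s -> sweep_state S wit (set_reg s r k).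
Proof.
by move=> r0 st; apply: sweep_state_arr (st) => //; apply: graph_store_reg (st_graph st).
Qed.

Lemma sweep_state_add S wit s x : sweep_state S wit s ->
  sweep_state (x |: S) wit (set_arr s 3 x 1).
Proof.
case=> gs h4 h5 h6 h3 h7; split=> //.
by move=> y; rewrite /= (inj_eq val_inj) !inE h3; case: eqVneq.
Qed.

Lemma wit_gt0 S wit s (x : 'I_n) : sweep_state S wit s -> (0 < arr s 7 x) = (wit x != None).
Proof. by move=> /st_wit ->; case: (wit x). Qed.

Lemma set_eq0 S wit s (x : 'I_n) : sweep_state S wit s -> (arr s 3 x == 0) = (x \notin S).
Proof. by move=> /st_set ->; rewrite eqb0. Qed.

Lemma size_queue : size q = n.
Proof. by rewrite -(card_uniqP uq) -[RHS]card_ord; apply: eq_card => x; rewrite q_all. Qed.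

Lemma runs_flush i j S wit (p : 'I_n) s t : greedy_inv i j.+1 S wit -> sweep_state S wit s ->
  reg s 10 = p -> idx p = j -> (forall x, idx x < i -> d x <= d p) ->
  60 + 31 * size (nb p) <= t ->
  runs w flush s t (fun t' s' => [/\ t <= t' + (60 + 31 * size (nb p)),
    exists2 S', greedy_inv i j S' wit & sweep_state S' wit s',
    reg s' 3 = reg s 3, reg s' 8 = reg s 8 & reg s' 9 = reg s 9]).
Proof.
move=> I st r10 ip maxp ct.
apply: runs_if => [|/=|/=]; first by rewrite /=; clear - ct; lia.
  rewrite mod0n r10 (wit_gt0 _ st) (set_eq0 _ st) => /andP[wp pS].
  case wv : (wit p) wp => [v|//] _.
  pose P (y : 'I_n) := [&& d y == d p, wit y != None & y \notin S].
  apply: runs_seq.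
  apply: (@runs_search w n nb off w_n w_off 10 p _ P); rewrite ?r10 //.
  - exact: st_graph st.
  - move=> s' y e e' r6; rewrite /= r6 e e' // r10 mod0n (wit_gt0 _ st) (set_eq0 _ st).
    by rewrite !(st_depth st).
  - by clear - ct; rewrite /=; lia.
  rewrite /= => s1 t1 ct1 eA eR gs1 fnd.
  have st1 := sweep_state_arr gs1 eA st.
  have r110 : reg s1 10 = p by rewrite eR.
  (* The three branches differ only in what they put into register 11; the two selections that
     follow are common. *)
  pose post t' s' := exists2 y, partner G root d par S wit p v y &
    [/\ sweep_state S wit s', reg s' 10 = p, reg s' 11 = y &
      [/\ t <= t' + (45 + 31 * size (nb p)), reg s' 3 = reg s 3, reg s' 8 = reg s 8
        & reg s' 9 = reg s 9]].
  have postP t' s2 y : partner G root d par S wit p v y -> s2 = set_reg s1 11 y ->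
      t <= t' + (45 + 31 * size (nb p)) -> post t' s2.
    move=> Py -> ct'; exists y => //; split=> //; first exact: sweep_state_reg.
    by split=> //=; apply: eR.
  apply: runs_seq; apply: (@runs_conseq w _ _ _ post) => [t2 s2 [y Py [st2 r210 r211 [ct2 r3 r8 r9]]]|].
    apply: runs_seq; apply: runs_arr => /=; first by clear - ct ct2; lia.
    apply: runs_arr => /=; first by clear - ct ct2; lia.
    rewrite r210 r211 w1; split=> //; first by clear - ct ct2; lia.
    exists (p |: (y |: S)); first exact: (greedy_flush bG vG L q_all q_sorted ip maxp wv pS Py I).
    by rewrite setUCA; do 2!apply: sweep_state_add.
  apply: runs_if => [|/=|/=]; first by rewrite /=; clear - ct ct1; lia.
    rewrite mod0n; case: fnd => [[-> //]|[y /andP[yp /and3P[/eqP dy wy yS]] r7] _].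
    apply: runs_reg => /=; first by rewrite /=; clear - ct ct1; lia.
    apply: (postP _ _ y); last by clear - ct ct1; lia.
      by apply: Sibling; rewrite // -(nbP p).2.
    by rewrite r7 w1 subn1.
  rewrite mod0n -leqNgt; case: fnd => [[_ none] _|[y _ ->] //].
  have H y : adj G p y -> d y = d p -> y \notin S -> wit y = None.
    rewrite -(nbP p).2 => /none; rewrite /P => nP dy yS; apply/eqP; apply: contraNT nP => wy.
    by rewrite dy eqxx wy yS.
  apply: runs_if => [|/=|/=]; first by rewrite /=; clear - ct ct1; lia.
    rewrite mod0n r110 pos_root => /andP[pr]; rewrite (st_par st1) // (set_eq0 _ st1) => ppS.
    apply: runs_reg => /=; first by rewrite /=; clear - ct ct1; lia.
    apply: (postP _ _ (par p)); last by clear - ct ct1; lia.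
      exact: Parent.
    by rewrite r110 (st_par st1).
  rewrite mod0n r110 pos_root => nb1; apply: runs_reg => /=; first by rewrite /=; clear - ct ct1; lia.
  apply: (postP _ _ v); last by clear - ct ct1; lia.
    apply: Child => // pr; move: nb1; rewrite pr (st_par st1) // (set_eq0 _ st1).
    by rewrite negbK.
  by rewrite r110 (st_wit st1) wv w1 subn1.
rewrite mod0n r10 (wit_gt0 _ st) (set_eq0 _ st) negb_and !negbK => h.
apply: runs_skip; first by clear - ct; lia.
split=> //; first by clear - ct; lia.
by exists S => //; apply: (greedy_flush_skip q_all ip maxp) I => wp; case/orP: h wp => [->|].
Qed.

Lemma runs_find_dominator S wit (x : 'I_n) s t Q : sweep_state S wit s -> reg s 3 = x ->
  14 + 20 * size (nb x) <= t ->
  (forall s' t', t <= t' + (14 + 20 * size (nb x)) -> sweep_state S wit s' ->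
     (forall r, r \notin [:: 4; 5; 6; 7] -> reg s' r = reg s r) ->
     holds w s' undominated_test = ~~ dom G S x -> Q t' s') ->
  runs w find_dominator s t Q.
Proof.
move=> st r3 ct post.
apply: (@runs_search w n nb off w_n w_off 3 x _ (mem S)) => //.
- exact: st_graph st.
- by move=> s' y e _ r6; rewrite /= r6 e mod0n (st_set st) lt0b.
move=> s1 t1 ct1 eA eR gs1 fnd; have st1 := sweep_state_arr gs1 eA st.
apply: post => //; rewrite /= mod0n (eR 3) // r3 (set_eq0 _ st1).
case: fnd => [[-> none]|[y /andP[yx yS] ->]].
  rewrite eqxx /=; congr (~~ _); apply/idP/domP => [xS|[y yS /predU1P[->//|xy]]].
    by exists x; rewrite // /cl eqxx.
  have yx : y \in nb x by rewrite (nbP x).2.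
  by case/negP: (none y yx).
apply/esym/negbTE; rewrite negbK; apply/domP; exists y => //.
by rewrite /cl -(nbP x).2 yx orbT.
Qed.

Lemma runs_mark i j S wit (x : 'I_n) s t : greedy_inv i.+1 j S wit -> sweep_state S wit s ->
  reg s 3 = x -> idx x = i -> (forall b, idx b < j -> d b < d x) ->
  33 + 20 * size (nb x) <= t ->
  runs w mark s t (fun t' s' => [/\ t <= t' + (33 + 20 * size (nb x)),
    exists2 wit', greedy_inv i j S wit' & sweep_state S wit' s',
    reg s' 8 = reg s 8 & reg s' 9 = reg s 9]).
Proof.
move=> I st r3 ix dj ct; apply: runs_seq.
apply: (runs_find_dominator st r3); first by clear - ct; lia.
move=> s1 t1 ct1 st1 eR und; have r13 : reg s1 3 = x by rewrite eR.
have testE : holds w s1 (And (Lt (Cst 0) (Reg 3)) undominated_test)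
    = (x != root) && ~~ dom G S x.
  by rewrite -und -pos_root -r13 -[X in _ = (X < _) && _](mod0n (2 ^ w)).
apply: runs_if; rewrite ?testE; first by rewrite /=; clear - ct ct1; lia.
  move=> /andP[xr nx].
  apply: runs_arr => /=; first by rewrite /=; clear - ct ct1; lia.
  rewrite r13 w1 ord_mod // (st_par st1) //.
  split; rewrite ?eR //; first by rewrite /=; clear - ct ct1; lia.
  exists (fun b => if b == par x then Some x else wit b).
    exact: greedy_mark.
  case: st1 => gs h4 h5 h6 h3 h7; split=> //.
  by move=> y; rewrite /= (inj_eq val_inj) h7; case: eqVneq.
rewrite negb_and !negbK => h.
apply: runs_skip; first by rewrite /=; clear - ct ct1; lia.
split; rewrite ?eR //; first by rewrite /=; clear - ct ct1; lia.
by exists wit => //; apply: (greedy_mark_skip q_all ix _ dj) I; case/orP: h => [/eqP|]; auto.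
Qed.

(** 81 = 21 + 60: loop test and two assignments, then the bound of [runs_flush]. *)
Definition flush_cost u := 81 + 31 * size (nb u).
(** 60 exceeds 33 + 14 + 11: the fixed part of [mark], the failing test of [flush_levels] and the
    outer loop. *)
Definition mark_cost u := 60 + 20 * size (nb u).
(** A potential: the budget still owed to the queue entries not yet treated. *)
Definition cost_upto (f : 'I_n -> nat) i := \sum_(x <- take i q) f x.

Lemma cost_uptoS f i : i < size q -> cost_upto f i.+1 = cost_upto f i + f (nth root q i).
Proof. by move=> iq; rewrite /cost_upto (take_nth root) // -cats1 big_cat big_seq1. Qed.

(** A single call may serve many vertices, so its cost is charged to the decrease of [j]; [F] is
    budget reserved for what follows. *)
Lemma runs_flush_levels i j S wit (x : 'I_n) s t F : greedy_inv i.+1 j S wit -> sweep_state S wit s ->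
  reg s 3 = x -> reg s 8 = i -> reg s 9 = j -> idx x = i -> j <= size q ->
  F + 14 + cost_upto flush_cost j <= t ->
  runs w flush_levels s t (fun t' s' => exists j' S',
    [/\ greedy_inv i.+1 j' S' wit, sweep_state S' wit s', j' <= size q,
        (forall b, idx b < j' -> d b < d x) &
        [/\ reg s' 3 = x, reg s' 8 = i, reg s' 9 = j' & F + cost_upto flush_cost j' <= t']]).
Proof.
move=> I0 st0 r03 r08 r09 ix jq ct.
pose J r s' := exists j' S', [/\ greedy_inv i.+1 j' S' wit, sweep_state S' wit s', j' <= size q &
  [/\ reg s' 3 = x, reg s' 8 = i, reg s' 9 = j' & F + 14 + cost_upto flush_cost j' <= r]].
apply: (runs_while (I := J)).
- by move=> r s1 [j1 [S1 [_ _ _ [_ _ _ cr]]]] /=; clear - cr; lia.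
- move=> r s1 [[|j1] [S1 [I st j1q [r3 r8 r9 cr]]]] /=; rewrite mod0n r9 // w1 subn1 /= r3.
  rewrite (st_queue st) // !(st_depth st) ltnS -leqNgt => dxp.
  rewrite cost_uptoS // in cr; set p := nth root q j1 in dxp cr *.
  have cp : flush_cost p = 81 + 31 * size (nb p) by [].
  apply: runs_seq; apply: runs_reg => /=; first by clear - cr cp; lia.
  rewrite r9 w1 subn1 /=.
  apply: runs_seq; apply: runs_reg => /=; first by clear - cr cp; lia.
  rewrite (st_queue st) // -/p.
  have ip : idx p = j1 by rewrite index_uniq.
  apply: runs_conseq (runs_flush I (p := p) _ _ ip _ _) => //.
  + move=> r' s2 [cr' [S2 I2 st2] /= r23 r28 r29]; exists j1, S2; split=> //; first exact: ltnW.
    by split; rewrite ?r23 ?r28 //; clear - cr cp cr'; lia.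
  + by do 2!apply: sweep_state_reg => //.
  + by move=> y yi; apply: leq_trans dxp; apply: q_sorted; rewrite ix.
  by clear - cr cp; lia.
- move=> r s1 [j1 [S1 [I st j1q [r3 r8 r9 cr]]]] /=.
  rewrite mod0n r9 w1 r3 (st_depth st) => ex; exists j1, S1; split=> //.
    case: j1 {I cr r9} j1q ex => // j1 j1q; rewrite subn1 /= (st_queue st) // (st_depth st) negbK.
    rewrite ltnS => lt b bj; apply: leq_ltn_trans lt; apply: q_sorted.
    by rewrite index_uniq.
  by split=> //; clear - cr; lia.
by exists j, S.
Qed.

Lemma runs_sweep s t Q F : sweep_state set0 (fun=> None) s ->
  F + 10 + \sum_u (mark_cost u + flush_cost u) <= t ->
  (forall s' t' S wit, F <= t' -> greedy_inv 0 0 S wit -> sweep_state S wit s' -> Q t' s') ->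
  runs w sweep s t Q.
Proof.
move=> st; rewrite big_split /= => ct post; have sq := size_queue.
have [r0 _ _ _] := st_graph st.
have sum_q f : cost_upto f (size q) = \sum_u f u.
  by rewrite /cost_upto take_size big_uniq //=; apply: eq_bigl => x; rewrite q_all.
rewrite -!sum_q in ct.
apply: runs_seq; apply: runs_reg => /=; first by clear - ct; lia.
apply: runs_seq; apply: runs_reg => /=; first by clear - ct; lia.
rewrite r0 -sq.
pose J r s' := exists i j S wit, [/\ greedy_inv i j S wit, sweep_state S wit s',
  i <= size q, j <= size q /\ (i = 0 -> j = 0) &
  [/\ reg s' 8 = i, reg s' 9 = j &
      F + 4 + cost_upto mark_cost i + cost_upto flush_cost j <= r]].
apply: (runs_while (I := J)).
- by move=> r s1 [i [j [S [wit [_ _ _ _ [_ _ cr]]]]]] /=; clear - cr; lia.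
- move=> r s1 [[|i] [j [S [wit [I st1 iq [jq _] [r8 r9 cr]]]]]] /=; rewrite mod0n r8 // => _.
  rewrite cost_uptoS // in cr; set x := nth root q i in cr.
  have cx : mark_cost x = 60 + 20 * size (nb x) by [].
  have ix : idx x = i by rewrite index_uniq.
  apply: runs_seq; apply: runs_reg => /=; first by clear - cr cx; lia.
  apply: runs_seq; apply: runs_reg => /=; first by clear - cr cx; lia.
  rewrite r8 w1 subn1 /= (st_queue st1) // -/x; apply: runs_seq.
  set s2 := set_reg _ 3 _.
  have st2 : sweep_state S wit s2 by do 2!apply: sweep_state_reg => //.
  pose F' := F + 4 + cost_upto mark_cost i + (33 + 20 * size (nb x)).
  apply: runs_conseq (runs_flush_levels (F := F') I st2 _ _ _ ix jq _) => //; last first.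
    by rewrite /F'; clear - cr cx; lia.
  move=> r3 s3 [j3 [S3 [I3 st3 j3q dj3 [r33 r38 r39 cr3]]]].
  apply: runs_conseq (runs_mark I3 st3 r33 ix dj3 _); last by rewrite /F' in cr3; clear - cr3; lia.
  move=> r4 s4 [cr4 [wit4 I4 st4] r48 r49]; exists i, j3, S3, wit4; split=> //.
  + exact: ltnW.
  (* After entry 0 is examined, an unserved vertex would be strictly shallower than the first entry
     of a sorted queue. *)
  + split=> // i0; case: j3 dj3 j3q {I3 I4 cr3 r39 r49} => // j3 dj3 j3q.
    have /dj3 : idx (nth root q j3) < j3.+1 by rewrite index_uniq.
    by rewrite ltnNge q_sorted // ix i0.
  by split; rewrite ?r48 ?r49 //; rewrite /F' in cr3; clear - cr3 cr4; lia.
- move=> r s1 [i [j [S [wit [I st1 iq [jq ij] [r8 r9 cr]]]]]] /=; rewrite mod0n r8 -leqNgt leqn0.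
  move=> /eqP i0; move: I cr; rewrite i0 ij // => I cr; apply: post I st1.
  by clear - cr; lia.
exists (size q), (size q), set0, (fun=> None); split=> //.
- exact: greedy_init.
- by do 2!apply: sweep_state_reg => //.
split=> //.
by clear - ct; lia.
Qed.

Lemma runs_finish S wit s t Q : (exists y, adj G root y) ->
  greedy_inv 0 0 S wit -> sweep_state S wit s -> 40 + 20 * size (nb root) <= t ->
  (forall s' t', minimum_paired_dominating G (output n s') -> Q t' s') ->
  runs w finish s t Q.
Proof.
move=> [y0 ry0] I st ct post.
apply: runs_seq; apply: runs_reg => /=; first by clear - ct; lia.
rewrite mod0n; apply: runs_seq.
apply: (@runs_find_dominator S wit root); rewrite ?root0 //; first exact: sweep_state_reg.
  by clear - ct; lia.
move=> s1 t1 ct1 st1 eR und; have r13 : reg s1 3 = root by rewrite eR.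
have outP S' s' : sweep_state S' wit s' -> output n s' = S'.
  by move=> st'; apply/setP=> x; rewrite inE (set_eq0 _ st') negbK.
apply: runs_if; rewrite ?und; first by clear - ct ct1; rewrite /=; lia.
  move=> nr.
  have [y [E eE]] : exists y E, nb root = [::] ++ y :: E.
    by case: (nb root) (nbP root).2 => [/(_ y0)|y E _]; [rewrite ry0 | exists y, E].
  have ry : adj G root y by rewrite -(nbP root).2 eE inE eqxx.
  have [_ a0 _ a1] := st_graph st1.
  have := a1 root [::] y E eE; rewrite addn0 => a1y.
  apply: runs_seq; apply: runs_arr => /=; first by rewrite /=; clear - ct ct1; lia.
  apply: runs_arr => /=; first by rewrite /=; clear - ct ct1; lia.
  rewrite r13 w1 a0 a1y; apply: post.
  rewrite (outP (root |: (y |: S))); first exact: (greedy_done_root bG vG L I nr ry).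
  by rewrite setUCA; do 2!apply: sweep_state_add.
rewrite negbK => rS.
apply: runs_skip; first by rewrite /=; clear - ct ct1; lia.
by apply: post; rewrite (outP S) //; apply: greedy_done I rS.
Qed.

End Sweep.

Theorem theorem2p3 :
  exists (p : cmd) (c : nat),
    forall (n : nat) (G : graph 'I_n) (nb : 'I_n -> seq 'I_n) (v : 'S_n) (w : nat),
      2 <= n ->
      verts G = [set: 'I_n] ->
      block_graph G ->
      no_isolated_vertex G ->
      (forall i j k : 'I_n, i < j -> j < k ->
         adj G (v i) (v j) -> adj G (v i) (v k) -> adj G (v j) (v k)) ->
      adjacency_lists G nb ->
      c * (#|edges G| + n) <= 2 ^ w ->
      exists (t : nat) (s : store),
        [/\ exec w p (input nb v) t s,
            t <= c * (#|edges G| + n)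
          & minimum_paired_dominating G (output n s)].
Proof.
(* The budgets add up to at most 60 + 164[n] + 103[D], where the degree sum [D] is at most twice the
   number of edges and 60 is at most 30[n]. The same constant makes words large enough for [n.+1]
   and all list positions. *)
exists (Seq bfs (Seq sweep finish)), 256 => n G nb v w n2 vG bG isoG _ nbP cw.
suff [t [s [ex le out]]] : runs w (Seq bfs (Seq sweep finish)) (input nb v)
    (256 * (#|edges G| + n)) (fun _ s => minimum_paired_dominating G (output n s)).
  by exists t, s.
have sG : simple_graph G by case: bG.
have deg := sum_degrees sG nbP; have off_le := offset_bound nb.
move: #|edges G| deg cw => m deg cw.
have w_n : n.+1 < 2 ^ w by clear - n2 cw; lia.
have w_off u : offset nb u + size (nb u) < 2 ^ w.
  by have := off_le u; clear - n2 cw deg; lia.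
pose root : 'I_n := Ordinal (ltnW n2).
have root0 : root = 0 :> nat by [].
have deg_root : size (nb root) <= \sum_u size (nb u).
  by apply: leq_trans (off_le root); rewrite leq_addl.
have bfsE : \sum_u bfs_cost nb u = 23 * n + 32 * \sum_u size (nb u).
  by rewrite big_split /= sum_nat_const card_ord mulnC big_distrr.
have sweepE : \sum_u (mark_cost nb u + flush_cost nb u) = 141 * n + 51 * \sum_u size (nb u).
  rewrite (eq_bigr (fun u => 141 + 51 * size (nb u))) => [|u _]; last first.
    by rewrite /mark_cost /flush_cost; lia.
  by rewrite big_split /= sum_nat_const card_ord mulnC big_distrr.
apply: runs_seq; apply: (runs_bfs root0 vG bG nbP w_n w_off).
- exact: graph_store_input.
- by move=> [|[|[|a]]].
- by [].
- by rewrite bfsE; clear - n2 deg; lia.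
move=> s1 t1 q d par; rewrite bfsE => ct1 gs1 [L uq q_all q_sorted [h4 h5 h6 h37]].
apply: runs_seq; apply: (runs_sweep root0 vG bG nbP w_n w_off L uq q_all q_sorted
  (F := 40 + 20 * size (nb root))).
- by split=> // x; case: (h37 x); rewrite ?inE.
- by rewrite sweepE; clear - ct1 n2 deg deg_root; lia.
move=> s2 t2 S wit ct2 I st2.
apply: (runs_finish root0 vG bG nbP w_n w_off L _ I st2) => //.
by apply: isoG; rewrite vG inE.
Qed.
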